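(* Let the nonlinear system $\dot{\mathbf{x}}=\mathbf{f}(\mathbf{x})+\mathbf{g}(\mathbf{x})\mathbf{u}$, $\mathbf{y}=\mathbf{h}(\mathbf{x})$, with $\mathbf{x}\in\mathbb{R}^n$, $\mathbf{u}\in\mathbb{R}^m$ and vector-valued output $\mathbf{y}$, be in polynomial form (or be approximated as such) with $$\mathbf{f}(\mathbf{x})=\sum_{p=1}^\infty\mathbf{F}_p\mathbf{x}^{\otimes p},\qquad \mathbf{g}(\mathbf{x})=\sum_{p=0}^\infty\mathbf{G}_p(\mathbf{I}_m\otimes\mathbf{x}^{\otimes p}),\qquad \mathbf{h}(\mathbf{x})=\sum_{p=1}^\infty\mathbf{H}_p\mathbf{x}^{\otimes p},$$ where $\mathbf{G}_p=[\mathbf{G}_p^{(1)}\ \mathbf{G}_p^{(2)}\ \cdots\ \mathbf{G}_p^{(m)}]$ with $\mathbf{G}_p^{(\ell)}\in\mathbb{R}^{n\times n^p}$. Let the nonlinear balancing transformation be approximated in polynomial form as $$\mathbf{x}=\bar{\boldsymbol{\Phi}}(\bar{\mathbf{z}})=\bar{\mathbf{T}}_1\bar{\mathbf{z}}+\bar{\mathbf{T}}_2\bar{\mathbf{z}}^{\otimes2}+\bar{\mathbf{T}}_3\bar{\mathbf{z}}^{\otimes3}+\cdots,\qquad \bar{\mathbf{T}}_k\in\mathbb{R}^{n\times n^k},$$ with $\bar{\mathbf{T}}_1$ invertible, such that in the $\bar{\mathbf{z}}$ coordinates the balanced realization is $\dot{\bar{\mathbf{z}}}=\bar{\mathbf{f}}(\bar{\mathbf{z}})+\bar{\mathbf{g}}(\bar{\mathbf{z}})\mathbf{u}$,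 $\mathbf{y}=\bar{\mathbf{h}}(\bar{\mathbf{z}})$, where $$\bar{\mathbf{f}}(\bar{\mathbf{z}})=\Big[\tfrac{\partial\bar{\boldsymbol{\Phi}}(\bar{\mathbf{z}})}{\partial\bar{\mathbf{z}}}\Big]^{-1}\mathbf{f}(\bar{\boldsymbol{\Phi}}(\bar{\mathbf{z}})),\quad \bar{\mathbf{g}}(\bar{\mathbf{z}})=\Big[\tfrac{\partial\bar{\boldsymbol{\Phi}}(\bar{\mathbf{z}})}{\partial\bar{\mathbf{z}}}\Big]^{-1}\mathbf{g}(\bar{\boldsymbol{\Phi}}(\bar{\mathbf{z}})),\quad \bar{\mathbf{h}}(\bar{\mathbf{z}})=\mathbf{h}(\bar{\boldsymbol{\Phi}}(\bar{\mathbf{z}})).$$ Then a local polynomial approximation to the balanced realization is given by $$\bar{\mathbf{f}}(\bar{\mathbf{z}})=\sum_{p=1}^\infty\bar{\mathbf{F}}_p\bar{\mathbf{z}}^{\otimes p},\qquad \bar{\mathbf{g}}(\bar{\mathbf{z}})=\sum_{p=0}^\infty\bar{\mathbf{G}}_p(\mathbf{I}_m\otimes\bar{\mathbf{z}}^{\otimes p}),\qquad \bar{\mathbf{h}}(\bar{\mathbf{z}})=\sum_{p=1}^\infty\bar{\mathbf{H}}_p\bar{\mathbf{z}}^{\otimes p},$$ with coefficients given (recursively in $k$) as follows. (i) Drift, for $k\ge1$: $$\bar{\mathbf{F}}_k=\bar{\mathbf{T}}_1^{-1}\Big[\sum_{j=1}^k\mathbf{F}_j\bar{\mathcal{T}}_{j,k}-\sum_{i=2}^k\bar{\mathbf{T}}_i\,\mathcal{L}_i(\bar{\mathbf{F}}_{k-i+1})\Big].$$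 (ii) Input map, for $k\ge0$: $\bar{\mathbf{G}}_k=[\bar{\mathbf{G}}_k^{(1)}\ \bar{\mathbf{G}}_k^{(2)}\ \cdots\ \bar{\mathbf{G}}_k^{(m)}]$ where, for $\ell=1,\dots,m$, $$\bar{\mathbf{G}}_k^{(\ell)}=\bar{\mathbf{T}}_1^{-1}\Big[\sum_{j=0}^k\mathbf{G}_j^{(\ell)}\bar{\mathcal{T}}_{j,k}-\sum_{i=2}^{k+1}\bar{\mathbf{T}}_i\,\mathcal{L}_i(\bar{\mathbf{G}}^{(\ell)}_{k-i+1})\Big].$$ (iii) Output map, for $k\ge1$: $$\bar{\mathbf{H}}_k=\sum_{j=1}^k\mathbf{H}_j\bar{\mathcal{T}}_{j,k}.$$ Here $\mathcal{L}_i(\cdot)$ is the $i$-way Lyapunov matrix, and $\bar{\mathcal{T}}_{j,k}$ is the sum of all unique tensor products of the $\bar{\mathbf{T}}_i$ with $j$ factors and $n^k$ columns (with $\bar{\mathcal{T}}_{0,0}=1$ and $\bar{\mathcal{T}}_{0,k}=0$ for $k\ge1$).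
   Context: Kronecker notation. $\otimes$ is the Kronecker product; $\mathbf{x}^{\otimes k}=\mathbf{x}\otimes\cdots\otimes\mathbf{x}\in\mathbb{R}^{n^k}$ ($k$ factors) for $\mathbf{x}\in\mathbb{R}^n$, with $\mathbf{x}^{\otimes0}=1$. Given $\bar{\mathbf{T}}_k\in\mathbb{R}^{n\times n^k}$ ($k\ge1$), the sum of all unique tensor products with $p\ge 1$ factors and $n^q$ columns is $$\bar{\mathcal{T}}_{p,q}=\sum_{i_1+\cdots+i_p=q,\; i_1,\dots,i_p\ge1}\bar{\mathbf{T}}_{i_1}\otimes\cdots\otimes\bar{\mathbf{T}}_{i_p}\in\mathbb{R}^{n^p\times n^q},$$ over ordered $p$-tuples of positive integers. For $\mathbf{A}\in\mathbb{R}^{p\times q}$, the $k$-way Lyapunov matrix is $$\mathcal{L}_k(\mathbf{A})=\sum_{i=1}^k\underbrace{\mathbf{I}_p\otimes\cdots\otimes\mathbf{A}\otimes\cdots\otimes\mathbf{I}_p}_{k\text{ factors, }\mathbf{A}\text{ in the }i\text{th position}}\in\mathbb{R}^{p^k\times p^{k-1}q}.$$ Empty sums are zero. Series convention. All expansions are power series about the origin, with series taken to infinity. Equality of a function with a series, or ''local polynomial approximation'', means that for each $k$ the homogeneous degree-$k$ part of the Taylor expansion at the origin of the function is the $k$-th term of the series (truncating at a finite degree gives an approximation near the origin). Setting. The Jacobian linearization of the system at the origin is minimal, asymptotically stable, and has distinct Hankel singular values. The energy functions, assumed to exist, be finite, and be smooth near the origin, are $$\mathcal{E}_c(\mathbf{x}_0)=\min_{\mathbf{u}\in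 L_2(-\infty,0),\ \mathbf{x}(-\infty)=0,\ \mathbf{x}(0)=\mathbf{x}_0}\tfrac12\int_{-\infty}^0\|\mathbf{u}(t)\|^2dt,\qquad \mathcal{E}_o(\mathbf{x}_0)=\tfrac12\int_0^\infty\|\mathbf{y}(t)\|^2dt\ \text{ with }\mathbf{x}(0)=\mathbf{x}_0,\ \mathbf{u}\equiv0.$$ A balancing transformation is a smooth coordinate transformation $\mathbf{x}=\bar{\boldsymbol{\Phi}}(\bar{\mathbf{z}})$ near the origin, $\bar{\boldsymbol{\Phi}}(0)=0$, such that for some functions $\bar\sigma_i$ (the singular value functions) $$\mathcal{E}_c(\bar{\boldsymbol{\Phi}}(\bar{\mathbf{z}}))=\tfrac12\sum_{i=1}^n\frac{\bar z_i^2}{\bar\sigma_i(\bar z_i)},\qquad \mathcal{E}_o(\bar{\boldsymbol{\Phi}}(\bar{\mathbf{z}}))=\tfrac12\sum_{i=1}^n\bar z_i^2\,\bar\sigma_i(\bar z_i).$$ The Jacobian of the balancing transformation is assumed invertible near the origin. *)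

(* Defs.v *)
From HB Require Import structures.
From mathcomp Require Import all_boot all_order all_algebra.
From mathcomp Require Import mxtens.
From mathcomp Require Import all_classical all_reals all_analysis.

Set Implicit Arguments.
Unset Strict Implicit.
Unset Printing Implicit Defensive.

Import Order.TTheory GRing.Theory Num.Theory.
Import numFieldNormedType.Exports.

Local Open Scope classical_set_scope.
Local Open Scope ring_scope.

(* Matrices whose dimensions are provably, but not definitionally, equal are
   identified by [recast]. It would return 0 on a genuine mismatch; the
   lemmas [tpart_size], [lyap_index_rows], [lyap_index_cols] and
   [lyap_arg_cols] show that this never happens where it is used. *)
Definition recast (R : realType) (a b a' b' : nat) (A : 'M[R]_(a, b)) :
  'M[R]_(a', b') := conform_mx 0 A.

Lemma recastE (R : realType) (a b a' b' : nat) (e : (a = a') * (b = b'))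
  (A : 'M[R]_(a, b)) : recast a' b' A = castmx e A.
Proof.
by case: e => ea eb; case: _ / ea; case: _ / eb; rewrite /recast conform_mx_id.
Qed.

Definition kpow (R : realType) (n : nat) (x : 'cV[R]_n) (k : nat) :
  'cV[R]_(n ^ k) := castmx (erefl, exp1n k) (ntensmx x k).

(* T_(i_1) (x) ... (x) T_(i_p) for s = [:: i_1; ...; i_p] *)
Fixpoint tprod (R : realType) (n : nat) (T : forall k, 'M[R]_(n, n ^ k))
    (s : seq nat) : 'M[R]_(n ^ size s, n ^ sumn s) :=
  match s with
  | [::] => 1%:M
  | i :: s' => castmx (esym (expnS n (size s')), esym (expnD n i (sumn s')))
                      (tensmx (T i) (tprod T s'))
  end.

(* For p = 0 the only tuple is empty, so that Tcal 0 0 = 1 and Tcal 0 q = 0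
   for q > 0. *)
Definition Tcal (R : realType) (n : nat) (T : forall k, 'M[R]_(n, n ^ k))
    (p q : nat) : 'M[R]_(n ^ p, n ^ q) :=
  \sum_(t : p.-tuple 'I_q.+1 | all (leq 1) (map val t)
                               && (sumn (map val t) == q))
     recast (n ^ p) (n ^ q) (tprod T (map val t)).

Lemma tpart_size (n p q : nat) (t : p.-tuple 'I_q.+1) :
  sumn (map val t) == q ->
  ((n ^ size (map val t) = n ^ p)%N * (n ^ sumn (map val t) = n ^ q)%N)%type.
Proof. by move=> /eqP ->; rewrite size_map size_tuple. Qed.

(* Here i = 0, ..., k-1 is the number of identity factors left of A. *)
Definition lyap (R : realType) (p q k : nat) (A : 'M[R]_(p, q)) :
    'M[R]_(p ^ k, p ^ k.-1 * q) :=
  \sum_(0 <= i < k)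
     recast (p ^ k) (p ^ k.-1 * q)
       (tensmx (ntensmx (1%:M : 'M[R]_p) i)
               (tensmx A (ntensmx (1%:M : 'M[R]_p) (k.-1 - i)))).

Lemma lyap_index_rows (p k i : nat) :
  (i < k -> p ^ i * (p * p ^ (k.-1 - i)) = p ^ k)%N.
Proof.
case: k => // k; rewrite ltnS => le_ik.
by rewrite -expnS -expnD /= -subSn // subnKC // leqW.
Qed.

Lemma lyap_index_cols (p q k i : nat) :
  (i < k -> p ^ i * (q * p ^ (k.-1 - i)) = p ^ k.-1 * q)%N.
Proof.
case: k => // k; rewrite ltnS => le_ik /=.
by rewrite mulnCA -expnD subnKC // mulnC.
Qed.

Lemma lyap_arg_cols (n k i : nat) :
  (2 <= i <= k.+1 -> n ^ i.-1 * n ^ (k.+1 - i) = n ^ k)%N.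
Proof. by case: i => // i /andP[_ le_ik]; rewrite -expnD subSS subnKC. Qed.

(* G^(l) in G = [G^(1) ... G^(m)] *)
Definition block (R : realType) (n m q : nat) (G : 'M[R]_(n, m * q))
    (l : 'I_m) : 'M[R]_(n, q) :=
  \matrix_(i, j) G i (mxtens_index (l, j)).

(* The series of f, h, Phi start at degree 1; C 0 plays no role. *)
Definition vec_term (R : realType) (n r : nat)
    (C : forall p, 'M[R]_(r, n ^ p)) (k : nat) (x : 'cV[R]_n) : 'cV[R]_r :=
  if k is 0 then 0 else C k *m kpow x k.

Definition input_term (R : realType) (n m : nat)
    (G : forall p, 'M[R]_(n, m * n ^ p)) (k : nat) (x : 'cV[R]_n) :
    'M[R]_(n, m) :=
  castmx (erefl, muln1 m) (G k *m tensmx (1%:M : 'M[R]_m) (kpow x k)).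

Definition unitvec (R : realType) (n : nat) (j : 'I_n) : 'cV[R]_n :=
  delta_mx j 0.
Arguments unitvec {R n} j.

Definition jac (R : realType) (n r : nat) (F : 'cV[R]_n -> 'cV[R]_r)
    (x : 'cV[R]_n) : 'M[R]_(r, n) :=
  \matrix_(i, j) ('D_(unitvec j) F x) i 0.

Definition partials (R : realType) (n : nat) (V : normedModType R)
    (s : seq 'I_n) (F : 'cV[R]_n -> V) : 'cV[R]_n -> V :=
  foldr (fun j F' => 'D_(unitvec j) F') F s.

(* C^oo on a neighborhood of the origin: all iterated partial derivatives
   exist and are Frechet differentiable on a common neighborhood. *)
Definition smooth_near0 (R : realType) (n : nat) (V : normedModType R)
    (F : 'cV[R]_n -> V) : Prop :=
  \forall x \near (0 : 'cV[R]_n),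
    forall s : seq 'I_n, differentiable (partials s F) x.

Definition taylor_part (R : realType) (n : nat) (V : normedModType R)
    (F : 'cV[R]_n -> V) (k : nat) (x : 'cV[R]_n) : V :=
  (k`!%:R)^-1 *: \sum_(s : k.-tuple 'I_n)
                    (\prod_(j <- s) x j 0) *: partials s F 0.

(* F(x) = sum_k P k x as a Taylor expansion at the origin *)
Definition has_series (R : realType) (n : nat) (V : normedModType R)
    (F : 'cV[R]_n -> V) (P : nat -> 'cV[R]_n -> V) : Prop :=
  smooth_near0 F /\ forall k x, taylor_part F k x = P k x.

Definition sqnorm (R : realType) (n : nat) (v : 'cV[R]_n) : R :=
  \sum_i v i 0 ^+ 2.

(* Caratheodory solutions of x' = F t x on I, as required by L_2 inputs *)
Definition is_solution (R : realType) (n : nat)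
    (F : R -> 'cV[R]_n -> 'cV[R]_n) (I : set R) (x : R -> 'cV[R]_n) : Prop :=
  forall s t, I s -> I t -> s <= t -> forall i : 'I_n,
    (@lebesgue_measure R).-integrable `[s, t]
      (fun tau => (F tau (x tau) i 0)%:E) /\
    x t i 0 - x s i 0 =
      \int[@lebesgue_measure R]_(tau in `[s, t]) F tau (x tau) i 0.

Definition L2_past (R : realType) (m : nat) (u : R -> 'cV[R]_m) : Prop :=
  (forall i, measurable_fun `]-oo, (0%R : R)[ (fun t => u t i 0)) /\
  (\int[@lebesgue_measure R]_(t in `]-oo, (0%R : R)[) (sqnorm (u t))%:E < +oo)%E.

Definition steers_to (R : realType) (n m : nat)
    (f : 'cV[R]_n -> 'cV[R]_n) (g : 'cV[R]_n -> 'M[R]_(n, m))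
    (x0 : 'cV[R]_n) (u : R -> 'cV[R]_m) : Prop :=
  exists x : R -> 'cV[R]_n,
    [/\ is_solution (fun t y => f y + g y *m u t) `]-oo, (0%R : R)] x,
        x t @[t --> -oo%R] --> (0 : 'cV[R]_n) & x 0 = x0].

Definition is_controllability_energy (R : realType) (n m : nat)
    (f : 'cV[R]_n -> 'cV[R]_n) (g : 'cV[R]_n -> 'M[R]_(n, m))
    (Ec : 'cV[R]_n -> R) : Prop :=
  let cost (u : R -> 'cV[R]_m) : \bar R :=
    ((2^-1)%:E *
      \int[@lebesgue_measure R]_(t in `]-oo, (0%R : R)[) (sqnorm (u t))%:E)%E in
  \forall x0 \near (0 : 'cV[R]_n),
    (exists u, [/\ L2_past u, steers_to f g x0 u & cost u = (Ec x0)%:E]) /\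
    (forall u, L2_past u -> steers_to f g x0 u -> ((Ec x0)%:E <= cost u)%E).

Definition is_observability_energy (R : realType) (n r : nat)
    (f : 'cV[R]_n -> 'cV[R]_n) (h : 'cV[R]_n -> 'cV[R]_r)
    (Eo : 'cV[R]_n -> R) : Prop :=
  \forall x0 \near (0 : 'cV[R]_n),
    let free x := is_solution (fun _ => f) `[(0%R : R), +oo[ x /\ x 0 = x0 in
    (exists x, free x) /\
    (forall x, free x ->
      (Eo x0)%:E = ((2^-1)%:E *
        \int[@lebesgue_measure R]_(t in `[(0%R : R), +oo[)
           (sqnorm (h (x t)))%:E)%E).

Definition expmx (R : realType) (n : nat) (A : 'M[R]_n) : 'M[R]_n :=
  lim ((fun N => \sum_(0 <= k < N)
          (k`!%:R)^-1 *: iter k (mulmx A) (1%:M : 'M[R]_n)) @ \oo).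

Definition impulse_response (R : realType) (n m r : nat) (A : 'M[R]_n)
    (B : 'M[R]_(n, m)) (C : 'M[R]_(r, n)) (t : R) : 'M[R]_(r, m) :=
  C *m expmx (t *: A) *m B.

Definition minimal (R : realType) (n m r : nat) (A : 'M[R]_n)
    (B : 'M[R]_(n, m)) (C : 'M[R]_(r, n)) : Prop :=
  forall (n' : nat) (A' : 'M[R]_n') (B' : 'M[R]_(n', m)) (C' : 'M[R]_(r, n')),
    (forall t, 0 <= t ->
       impulse_response A' B' C' t = impulse_response A B C t) ->
    (n <= n')%N.

Definition asymptotically_stable (R : realType) (n : nat) (A : 'M[R]_n) :
    Prop :=
  let sol := is_solution (fun _ y => A *m y) `[(0%R : R), +oo[ in
  (forall eps, 0 < eps -> exists2 delta, 0 < delta &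
     forall x, sol x -> `|x 0| < delta -> forall t, 0 <= t -> `|x t| < eps) /\
  (exists2 delta, 0 < delta &
     forall x, sol x -> `|x 0| < delta ->
       x t @[t --> +oo%R] --> (0 : 'cV[R]_n)).

Definition ctrl_gramian (R : realType) (n m : nat) (A : 'M[R]_n)
    (B : 'M[R]_(n, m)) : 'M[R]_n :=
  \matrix_(i, j) \int[@lebesgue_measure R]_(t in `[(0%R : R), +oo[)
    (expmx (t *: A) *m B *m B^T *m (expmx (t *: A))^T) i j.

Definition obs_gramian (R : realType) (n r : nat) (A : 'M[R]_n)
    (C : 'M[R]_(r, n)) : 'M[R]_n :=
  \matrix_(i, j) \int[@lebesgue_measure R]_(t in `[(0%R : R), +oo[)
    ((expmx (t *: A))^T *m C^T *m C *m expmx (t *: A)) i j.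

(* The Hankel singular values are the nonnegative square roots of the
   eigenvalues, with multiplicity, of the product of the Gramians. *)
Definition hankel_singular_values (R : realType) (n m r : nat) (A : 'M[R]_n)
    (B : 'M[R]_(n, m)) (C : 'M[R]_(r, n)) (s : 'I_n -> R) : Prop :=
  (forall i, 0 <= s i) /\
  char_poly (ctrl_gramian A B *m obs_gramian A C) =
    \prod_(i < n) ('X - (s i ^+ 2)%:P).

Definition distinct_hankel_singular_values (R : realType) (n m r : nat)
    (A : 'M[R]_n) (B : 'M[R]_(n, m)) (C : 'M[R]_(r, n)) : Prop :=
  exists2 s, hankel_singular_values A B C s & injective s.

(* The condition s i t != 0 makes the quotients below meaningful (in the
   library x / 0 = 0). *)
Definition is_balancing (R : realType) (n : nat) (Ec Eo : 'cV[R]_n -> R)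
    (Phi : 'cV[R]_n -> 'cV[R]_n) : Prop :=
  [/\ smooth_near0 Phi, Phi 0 = 0,
      \forall z \near (0 : 'cV[R]_n), jac Phi z \in unitmx
    & exists s : 'I_n -> R -> R,
      (forall i, \forall t \near (0 : R), s i t != 0) /\
      \forall z \near (0 : 'cV[R]_n),
        Ec (Phi z) = 2^-1 * \sum_i z i 0 ^+ 2 / s i (z i 0) /\
        Eo (Phi z) = 2^-1 * \sum_i z i 0 ^+ 2 * s i (z i 0)].

(* Main.v *)
Require Import Defs.
From HB Require Import structures.
From mathcomp Require Import all_boot all_order all_algebra.
From mathcomp Require Import mxtens ring lra zify.
From mathcomp Require Import all_classical all_reals all_analysis.

Import Order.TTheory GRing.Theory Num.Theory.
Import numFieldNormedType.Exports.

Local Open Scope classical_set_scope.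
Local Open Scope ring_scope.

Set Implicit Arguments.
Unset Strict Implicit.
Unset Printing Implicit Defensive.

(** Every Taylor part of a composite, of a product or of an inverse is a
universal expression in finitely many partial derivatives at the origin, so
the theorem is a comparison of coefficients in
  [jac Phi z *m fbar z = f (Phi z)]
together with the remark that all functions in sight are smooth near the
origin ([smooth_mx_comp], [smooth_mx_inv], [smooth_mx_jac]).

The right-hand side is a composition. Subtracting from [f] its Taylor
polynomial of degree [k] leaves a function all of whose partial derivatives of
order at most [k] vanish at the origin ([jet_flat]; this step rests on the
symmetry of second derivatives, [derive_sym]), and composing it with [Phi],
which fixes the origin, preserves this property ([flat_comp]). Hence the
degree [k] part of [f \o Phi] is that of a sum of terms
[F j *m kpow (Phi z) j], and since the degree [i] part of [Phi] is
[T i *m kpow z i], expanding the Kronecker power produces the sum of all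
products of [j] matrices [T i], which is [Tcal T j k] ([jetmx_Tcal],
[jetmx_comp]).

On the left-hand side, the degree [k] part of [jac Phi] is the Jacobian of the
degree [k + 1] part of [Phi] ([jetmx_jac]). The derivative of
[x |-> kpow x i] at [z] in the direction [W *m kpow z q] replaces in turn each
factor [z] of the Kronecker power by that direction, which is exactly what the
[i]-way Lyapunov matrix of [W] does to a Kronecker power of [z]
([jac_kpow], [lyap_kpow]). The term of degree one of [Phi] contributes
[T 1] times the unknown degree [k] part of [fbar], and the other terms involve
parts of lower degree only; inverting [T 1] gives the recursion
([jetmx_pullback]).

The input map is treated one column at a time, each column being a vector
field that is pulled back by [Phi] just as the drift is. The drift itself is
the case of a vector field without constant term, for which the degree zero
coefficient of the pulled-back field vanishes and the last summand of the
general recursion disappears. *)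

(** * Functions differentiable to a finite order on an open set *)

(** The difference of two functions that agree near [x] has derivative 0 at [x]. *)
Lemma near_eq_differentiable (R : numFieldType) (V W : normedModType R)
    (F G : V -> W) (x : V) :
  {near x, F =1 G} -> differentiable F x -> differentiable G x.
Proof.
move=> FG dF; pose H : V -> W := G - F.
have GE : G = F + H by rewrite /H addrC subrK.
suff dH : differentiable H x by rewrite GE; exact: differentiableD.
have HE : H \o shift x = cst (H x) + \0 +o_ 0 id.
  apply/eqaddoP => _/posnumP[e].
  have Hx : H x = 0.
    by rewrite /H -[LHS]/(G x - F x) (nbhs_singleton FG) subrr.
  have := FG; rewrite (near_shift 0) /= subr0.
  apply: filterS => h /= FGh; rewrite Hx.
  rewrite -[X in `|X|]/(G (h + x) - F (h + x) - (0 + 0)) FGh.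
  by rewrite subrr addr0 subr0 normr0 mulr_ge0.
have cst0 : continuous (\0 : V -> W) by move=> ?; exact: cst_continuous.
have H0 : 'd H x = \0 :> (V -> W) by apply: (diff_unique (df := \0)).
by apply/diff_locallyP; rewrite H0.
Qed.

Section Smooth.
Context {R : realType} {n : nat}.
Implicit Types (U W : set 'cV[R]_n) (F G : 'cV[R]_n -> R) (x z : 'cV[R]_n).

(** [F] is [N] times differentiable on [U]. Bounding the order makes closure
properties provable by induction on [N]: the partial derivatives of a product,
an inverse or a composite are built from functions of class [N] and from
partial derivatives of the factors. *)
Fixpoint Cn U N F : Prop :=
  (forall x, U x -> differentiable F x) /\
  (if N is N'.+1 then forall j : 'I_n, Cn U N' ('D_(unitvec j) F) else True).

Definition smooth_on U F := forall N, Cn U N F.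

Lemma open_eq_derive U F G x v : open U -> U x -> {in U, F =1 G} ->
  'D_v F x = 'D_v G x.
Proof.
move=> oU Ux FG; apply: near_eq_derive.
have : nbhs x U by exact: open_nbhs_nbhs.
by apply: filterS => y Uy; apply: FG; rewrite inE.
Qed.

Lemma open_eq_differentiable (V : normedModType R) (F G : 'cV[R]_n -> V) U x :
  open U -> U x -> {in U, F =1 G} -> differentiable F x -> differentiable G x.
Proof.
move=> oU Ux FG; apply: near_eq_differentiable.
have : nbhs x U by exact: open_nbhs_nbhs.
by apply: filterS => y Uy; apply: FG; rewrite inE.
Qed.

Lemma Cn_eq U N F G : open U -> {in U, F =1 G} -> Cn U N F -> Cn U N G.
Proof.
move=> oU; elim: N F G => [|N IH] F G FG /= [dF DF]; split => //.
- by move=> x Ux; exact: (open_eq_differentiable oU Ux FG (dF x Ux)).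
- by move=> x Ux; exact: (open_eq_differentiable oU Ux FG (dF x Ux)).
move=> j; apply: IH (DF j) => x /[!inE] Ux; exact: open_eq_derive FG.
Qed.

Lemma CnW U N F : Cn U N.+1 F -> Cn U N F.
Proof.
elim: N F => [|N IH] F; first by case.
by case=> dF DF; split=> // j; apply: IH; exact: DF.
Qed.

Lemma Cn_diff U N F x : Cn U N F -> U x -> differentiable F x.
Proof. by case: N => [|N] [+ _]; apply. Qed.

Lemma Cn_subset U W N F : U `<=` W -> Cn W N F -> Cn U N F.
Proof.
move=> UW; elim: N F => [|N IH] F [dF DF]; split=> //.
- by move=> x /UW; exact: dF.
- by move=> x /UW; exact: dF.
- by move=> j; exact/IH/DF.
Qed.

Lemma Cn_cst U N c : Cn U N (fun=> c).
Proof.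
elim: N c => [|N IH] c; split=> //=.
move=> j; rewrite (_ : 'D_(unitvec j) _ = (fun=> 0)) //.
by apply/funext => x; rewrite derive_cst.
Qed.

Lemma deriveD_fun F G x v : differentiable F x -> differentiable G x ->
  'D_v (fun y => F y + G y) x = 'D_v F x + 'D_v G x.
Proof. by move=> dF dG; apply: deriveD; exact: diff_derivable. Qed.

Lemma deriveM_fun F G x v : differentiable F x -> differentiable G x ->
  'D_v (fun y => F y * G y) x = 'D_v F x * G x + F x * 'D_v G x.
Proof.
move=> dF dG; rewrite [LHS](deriveM (diff_derivable dF) (diff_derivable dG)).
by rewrite addrC ![_ *: _]/(_ * _) mulrC.
Qed.

Lemma Cn_add U N F G : open U -> Cn U N F -> Cn U N G ->
  Cn U N (fun x => F x + G x).
Proof.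
move=> oU; elim: N F G => [|N IH] F G [dF DF] [dG DG]; split=> //.
- by move=> x Ux; apply: differentiableD; [exact: dF|exact: dG].
- by move=> x Ux; apply: differentiableD; [exact: dF|exact: dG].
move=> j; apply: Cn_eq (IH _ _ (DF j) (DG j)) => // x /[!inE] Ux.
by rewrite deriveD_fun; [|exact: dF|exact: dG].
Qed.

Lemma Cn_mul U N F G : open U -> Cn U N F -> Cn U N G ->
  Cn U N (fun x => F x * G x).
Proof.
move=> oU; elim: N F G => [|N IH] F G CF CG.
  by split=> // x Ux; apply: differentiableM; [exact: Cn_diff CF Ux|exact: Cn_diff CG Ux].
have dF x : U x -> differentiable F x by move/(Cn_diff CF).
have dG x : U x -> differentiable G x by move/(Cn_diff CG).
split; first by move=> x Ux; apply: differentiableM; [exact: dF|exact: dG].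
move=> j; have := Cn_add oU (IH _ _ (CF.2 j) (CnW CG)) (IH _ _ (CnW CF) (CG.2 j)).
apply: Cn_eq => // x /[!inE] Ux.
by rewrite deriveM_fun; [|exact: dF|exact: dG].
Qed.

Lemma Cn_sum U N (I : Type) (r : seq I) (P : pred I) (F : I -> 'cV[R]_n -> R) :
  open U -> (forall i, P i -> Cn U N (F i)) ->
  Cn U N (fun x => \sum_(i <- r | P i) F i x).
Proof.
move=> oU CF; elim: r => [|i r IH].
  by apply: Cn_eq (Cn_cst U N 0) => // x _; rewrite big_nil.
have [Pi|Pi] := boolP (P i).
  apply: Cn_eq (Cn_add oU (CF i Pi) IH) => // x _.
  by rewrite big_cons Pi.
by apply: Cn_eq IH => // x _; rewrite big_cons (negPf Pi).
Qed.

Lemma Cn_prod U N (I : Type) (r : seq I) (P : pred I) (F : I -> 'cV[R]_n -> R) :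
  open U -> (forall i, P i -> Cn U N (F i)) ->
  Cn U N (fun x => \prod_(i <- r | P i) F i x).
Proof.
move=> oU CF; elim: r => [|i r IH].
  by apply: Cn_eq (Cn_cst U N 1) => // x _; rewrite big_nil.
have [Pi|Pi] := boolP (P i).
  apply: Cn_eq (Cn_mul oU (CF i Pi) IH) => // x _.
  by rewrite big_cons Pi.
by apply: Cn_eq IH => // x _; rewrite big_cons (negPf Pi).
Qed.

Lemma derive_coord x (i j : 'I_n) :
  'D_(unitvec j) (fun y : 'cV[R]_n => y i 0) x = (i == j)%:R.
Proof.
have := @derive_mx R _ n 1 id x (unitvec j) (@derivable_id _ _ x (unitvec j)).
by rewrite derive_id => /matrixP/(_ i 0); rewrite !mxE eqxx andbT => ->.
Qed.

Lemma Cn_coord U N (i : 'I_n) : Cn U N (fun x => x i 0).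
Proof.
have d x : differentiable (fun x : 'cV[R]_n => x i 0) x
  by exact: differentiable_coord.
case: N => [|N]; split=> // j.
have E : 'D_(unitvec j) (fun x : 'cV[R]_n => x i 0) =
    (fun=> (i == j)%:R) :> ('cV[R]_n -> R).
  by apply/funext => x; exact: derive_coord.
by rewrite E; exact: Cn_cst.
Qed.

(** The derivative of [1 / F] is [- (1 / F) ^ 2] times that of [F], hence of
class [N] as soon as [1 / F] is. *)
Lemma Cn_inv U N F : open U -> (forall x, U x -> F x != 0) -> Cn U N F ->
  Cn U N (fun x => (F x)^-1).
Proof.
move=> oU F0; elim: N => [|N IH] CF.
  by split=> // x Ux; apply: differentiableV; [exact: Cn_diff CF Ux|exact: F0].
have dF x : U x -> differentiable F x by move/(Cn_diff CF).
split; first by move=> x Ux; apply: differentiableV; [exact: dF|exact: F0].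
move=> j; have iC := IH (CnW CF).
have := Cn_mul oU (Cn_mul oU (Cn_cst U N (-1)) (CF.2 j)) (Cn_mul oU iC iC).
apply: Cn_eq => // x /[!inE] Ux.
rewrite deriveV; [|exact: F0|exact/diff_derivable/dF].
rewrite [_ *: _]/(_ * _) mulN1r expr2 invfM !mulNr -[LHS]mulrN; exact: mulrC.
Qed.

End Smooth.

(** A matrix is the sum of its entries times the matrix units. *)
Lemma differentiable_mx (R : realType) (V : normedModType R) (m n : nat)
    (M : V -> 'M[R]_(m, n)) (x : V) :
  (forall i j, differentiable (fun y => M y i j) x) -> differentiable M x.
Proof.
move=> dM.
have -> : M = \sum_(i < m) \sum_(j < n) (fun y => M y i j *: delta_mx i j).
  apply/funext => y; rewrite {1}[M y]matrix_sum_delta fct_sumE.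
  by apply: eq_bigr => i _; rewrite fct_sumE.
apply: differentiable_sum => i; apply: differentiable_sum => j.
exact/differentiableZl/dM.
Qed.

Lemma differentiable_entry (R : realType) (V : normedModType R) (m n : nat)
    (M : V -> 'M[R]_(m, n)) (x : V) i j :
  differentiable M x -> differentiable (fun y => M y i j) x.
Proof.
move=> dM; exact: (differentiable_comp dM (differentiable_coord _ i j)).
Qed.

Lemma derive_entry (R : realType) (V : normedModType R) (m n : nat)
    (M : V -> 'M[R]_(m, n)) (x v : V) i j :
  differentiable M x -> 'D_v M x i j = 'D_v (fun y => M y i j) x.
Proof. by move=> dM; rewrite derive_mx ?mxE//; exact: diff_derivable. Qed.

Lemma derive_comp_cV (R : realType) (n p : nat) (Phi : 'cV[R]_n -> 'cV[R]_p)
    (F : 'cV[R]_p -> R) (x v : 'cV[R]_n) :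
  differentiable Phi x -> differentiable F (Phi x) ->
  'D_v (F \o Phi) x =
    \sum_i 'D_(unitvec i) F (Phi x) * 'D_v (fun y => Phi y i 0) x.
Proof.
move=> dP dF; have dFP := differentiable_comp dP dF.
rewrite (deriveE _ dFP) (diff_comp dP dF) /= -(deriveE _ dP).
rewrite [in LHS](matrix_sum_delta ('D_v Phi x)) linear_sum; apply: eq_bigr => i _.
rewrite linear_sum big_ord1 linearZ /= -deriveE// derive_entry//.
exact: mulrC.
Qed.

(** By the chain rule a partial derivative of [F \o Phi] is a sum of products of
partial derivatives of [Phi] and of composites of partial derivatives of [F],
to which the induction hypothesis applies. *)
Lemma Cn_comp (R : realType) (n p : nat) (U : set 'cV[R]_n) (W : set 'cV[R]_p)
    (Phi : 'cV[R]_n -> 'cV[R]_p) (F : 'cV[R]_p -> R) (N : nat) :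
  open U -> (forall x, U x -> W (Phi x)) ->
  (forall i, Cn U N (fun x => Phi x i 0)) -> Cn W N F -> Cn U N (F \o Phi).
Proof.
move=> oU UW; elim: N F => [|N IH] F CP CF.
  split=> // x Ux; apply: differentiable_comp.
    by apply: differentiable_mx => i j; rewrite ord1; exact: (CP i).1.
  exact/(CF.1)/UW.
have dP x : U x -> differentiable Phi x.
  by move=> Ux; apply: differentiable_mx => i j; rewrite ord1; exact: (CP i).1.
have dF x : U x -> differentiable F (Phi x) by move=> Ux; apply/(CF.1)/UW.
split; first by move=> x Ux; exact: differentiable_comp (dP x Ux) (dF x Ux).
move=> j; have C : Cn U N (fun x => \sum_i ('D_(unitvec i) F \o Phi) x *
    'D_(unitvec j) (fun y => Phi y i 0) x).
  apply: Cn_sum => // i _; apply: Cn_mul => //; last exact: (CP i).2.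
  by apply: IH; [move=> k; exact/CnW/CP|exact: CF.2].
apply: Cn_eq C => // x /[!inE] Ux.
by rewrite derive_comp_cV//; [exact: dP|exact: dF].
Qed.

(** * Symmetry of second derivatives *)

Section Schwarz.
Context {R : realType} {V : normedModType R}.

Lemma is_derive_line (F : V -> R) (y v : V) (s : R) :
  differentiable F (s *: v + y) ->
  is_derive s 1 (fun s => F (s *: v + y)) ('D_v F (s *: v + y)).
Proof.
move=> dF; pose g (s : R) := s *: v + y.
have dg : is_diff s g ( *:%R ^~ v).
  rewrite (_ : g = ( *:%R ^~ v : R -> V) + cst y)//.
  by apply: is_diff_eq; rewrite addr0.
have dFg : differentiable (F \o g) s by apply: differentiable_comp.
apply: DeriveDef; first exact: diff_derivable.
rewrite (deriveE _ dFg) diff_comp//= (deriveE _ dF) (@diff_val _ _ _ _ _ _ _ dg).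
by rewrite scale1r.
Qed.

(** The function [s |-> F (s v + t w + x) - F (s v + x)] increases over [[0, t]]
by the second difference; the mean value theorem turns this into [t] times a
difference of values of ['D_v F] near [x], and the differential of ['D_v F] at
[x] estimates that difference. *)
Lemma second_difference (U : set V) (F : V -> R) (x v w : V) (eps : R) :
  open U -> U x -> (forall y, U y -> differentiable F y) ->
  differentiable ('D_v F) x -> 0 < eps ->
  \forall t \near (0 : R)^'+,
    `|(F (t *: v + t *: w + x) - F (t *: v + x) - F (t *: w + x) + F x)
      - t ^+ 2 * 'D_w ('D_v F) x| <= eps * t ^+ 2.
Proof.
(* The norms of the two increments [c v + t w] and [c v] that occur below add
   up to at most [t K]; adding 1 keeps [K] positive when [v = w = 0]. *)
move=> oU Ux dF dDF eps0; pose K := `|v| + `|w| + `|v| + 1.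
have K0 : 0 < K by rewrite ltr_wpDl// !addr_ge0.
pose e := eps / K; have e0 : 0 < e by rewrite divr_gt0.
have : \forall h \near (0 : V), U (h + x) /\
  `|'D_v F (h + x) - ('D_v F x + 'd ('D_v F) x h)| <= e * `|h|.
  have nU : \forall h \near (0 : V), U (h + x).
    have : nbhs x U by exact: open_nbhs_nbhs.
    rewrite -[nbhs x U]/(\near x, U x) (near_shift 0) /= subr0; exact.
  near=> h; split; first by near: h.
  near: h.
  have := diff_locally dDF => /eqaddoP/(_ e e0).
  by apply: filterS => h.
move=> /nbhs_norm0P[d /= d0 dP].
have small (a b : R) (t : R) : 0 <= a <= t -> 0 <= b <= t -> t < d / K ->
   `|a *: v + b *: w| < d.
  move=> /andP[a0 at_] /andP[b0 bt]; rewrite ltr_pdivlMr// => tK.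
  apply: le_lt_trans tK; apply: le_trans (ler_normD _ _) _.
  have t0 : 0 <= t by exact: le_trans at_.
  rewrite !normrZ !ger0_norm// /K -[_ + 1]addrA mulrDr mulrDr ler_wpDr//.
    by rewrite mulr_ge0// addr_ge0.
  by rewrite lerD ?ler_wpM2r.
near=> t.
have t0 : 0 < t by [].
have td : t < d / K by near: t; apply: nbhs_right_lt; rewrite divr_gt0.
have htt : 0 <= t <= t by rewrite lexx ltW.
have zt : 0 <= (0 : R) <= t by apply/andP; split => //; exact: ltW.
pose phi s := F (s *: v + (t *: w + x)) - F (s *: v + x).
have dphi s : 0 <= s <= t -> is_derive s 1 phi
  ('D_v F (s *: v + (t *: w + x)) - 'D_v F (s *: v + x)).
  move=> st; apply: is_deriveB; apply: is_derive_line; apply: dF.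
    by rewrite addrA; apply: (dP _ _).1; exact: small st htt td.
  by apply: (dP _ _).1; rewrite -[s *: v]addr0 -(scale0r w); exact: small st zt td.
have [c ct] : exists2 c, c \in `]0, t[%R & phi t - phi 0 =
   ('D_v F (c *: v + (t *: w + x)) - 'D_v F (c *: v + x)) * (t - 0).
  apply: MVT => //.
    by move=> s; rewrite in_itv/= => /andP[s0 st]; apply: dphi; rewrite !ltW.
  apply: derivable_within_continuous => s; rewrite in_itv/= => st.
  by have [] := dphi s st.
rewrite subr0 /phi !scale0r !add0r !addrA => E.
have {}ct : 0 <= c <= t by move: ct; rewrite in_itv/= => /andP[c0 ct]; rewrite !ltW.
have [_] := dP _ (small c t t ct htt td).
have [_] := dP _ (small c 0 t ct zt td).
have assoc (X Y Z W : R) : X - Y - Z + W = X - Y - (Z - W) by ring.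
rewrite scale0r addr0 assoc E (deriveE _ dDF).
set A := 'D_v F (c *: v + t *: w + x); set B := 'D_v F (c *: v + x).
set L := 'd _ _ => hB; have -> : L (c *: v + t *: w) = L (c *: v) + t * L w.
  by rewrite linearD [L (t *: w)]linearZ.
rewrite addrA => hA.
have [c0 ct'] := andP ct.
have -> : (A - B) * t - t ^+ 2 * L w =
  t * ((A - ('D_v F x + L (c *: v) + t * L w)) - (B - ('D_v F x + L (c *: v)))).
  by ring.
rewrite normrM (gtr0_norm t0) expr2 mulrCA ler_pM2l//.
apply: le_trans (ler_normB _ _) _; apply: le_trans (lerD hA hB) _.
rewrite -mulrDr /e -mulrA ler_pM2l// mulrC ler_pdivrMr//.
apply: le_trans (lerD (ler_normD _ _) (lexx _)) _.
rewrite !normrZ (gtr0_norm t0) ger0_norm// /K.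
have : c * `|v| <= t * `|v| by rewrite ler_wpM2r.
by move: t0; clear; lra.
Unshelve. all: by end_near. Qed.

(** The second difference is symmetric in [v] and [w], so both iterated
derivatives are limits of one and the same quotient. *)
Lemma derive_sym (U : set V) (F : V -> R) (x v w : V) : open U -> U x ->
  (forall y, U y -> differentiable F y) ->
  differentiable ('D_v F) x -> differentiable ('D_w F) x ->
  'D_w ('D_v F) x = 'D_v ('D_w F) x.
Proof.
move=> oU Ux dF dv dw; apply/eqP; rewrite -subr_eq0 -normr_le0.
apply/ler_addgt0Pl => e e0; rewrite addr0.
have e20 : 0 < e / 2 by rewrite divr_gt0.
have S1 := second_difference w oU Ux dF dv e20.
have S2 := second_difference v oU Ux dF dw e20.
have t0P : \forall t \near (0 : R)^'+, 0 < t by exact: nbhs_right_gt.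
have [t [t0 [h1 h2]]] := filter_ex (filterI t0P (filterI S1 S2)).
move: h1 h2; rewrite [t *: w + t *: v]addrC [_ - F (t *: w + x) - _]addrAC.
set D := _ + F x; set P := 'D_w _ x; set Q := 'D_v _ x => h1 h2.
have t20 : 0 < t ^+ 2 by rewrite exprn_gt0.
rewrite -(ler_pM2l t20) -[X in X * `|_|](gtr0_norm t20) -normrM.
have -> : t ^+ 2 * (P - Q) = (D - t ^+ 2 * Q) - (D - t ^+ 2 * P) by ring.
apply: le_trans (ler_normB _ _) _; apply: le_trans (lerD h2 h1) _.
by rewrite -mulrDl -splitr mulrC.
Qed.

End Schwarz.

(** * Jets and flatness of scalar functions *)

Section Tau.
Context {R : realType} {n : nat}.
Implicit Types (F G : 'cV[R]_n -> R) (x z : 'cV[R]_n).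

(** The degree [k] Taylor part at the origin, evaluated at [z]. With
[E = \sum_j z_j d/dx_j] it is [E ^ k F 0 / k!]; one factor [E] is peeled off
per unit of degree, the innermost one first, so that inductions on [k]
generalize over [F]. *)
Fixpoint jet k F z : R :=
  if k is k'.+1
  then k%:R^-1 * \sum_(j < n) z j 0 * jet k' ('D_(unitvec j) F) z
  else F 0.

Lemma jetS k F z :
  k.+1%:R * jet k.+1 F z = \sum_(j < n) z j 0 * jet k ('D_(unitvec j) F) z.
Proof. by rewrite /= mulrA mulfV ?mul1r// pnatr_eq0. Qed.

Lemma jet_differentiable k F z : differentiable (jet k F) z.
Proof.
suff C N : Cn setT N (jet k F) by exact: Cn_diff (C 0%N) I.
elim: k F => [|k IH] F; first exact: Cn_cst.
apply: Cn_mul; [exact: openT|exact: Cn_cst|].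
apply: Cn_sum => [|j _]; first exact: openT.
by apply: Cn_mul; [exact: openT|exact: Cn_coord|exact: IH].
Qed.

(** All iterated partial derivatives of order at most [K] vanish at the origin.
The recursion is set up like that of [Cn], so that products and composites can
be handled by the same kind of induction. *)
Fixpoint flat K F : Prop :=
  F 0 = 0 /\ (if K is K'.+1 then forall j : 'I_n, flat K' ('D_(unitvec j) F)
              else True).

Lemma flatW K F : flat K.+1 F -> flat K F.
Proof.
elim: K F => [|K IH] F; first by case.
by case=> F0 DF; split=> // j; exact/IH/DF.
Qed.

Lemma flat_jet K k F z : (k <= K)%N -> flat K F -> jet k F z = 0.
Proof.
elim: k K F => [|k IH] [|K] F //; [by move=> _ []|by move=> _ []|].
rewrite ltnS => kK [_ DF] /=; rewrite big1 ?mulr0// => j _.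
by rewrite (IH K _ kK (DF j)) mulr0.
Qed.

Lemma flat0 K : flat K (fun=> 0).
Proof.
elim: K => [|K IH]; split=> // j.
rewrite (_ : 'D_(unitvec j) _ = (fun=> 0)) //.
by apply/funext => x; rewrite derive_cst.
Qed.

Variable U : set 'cV[R]_n.
Hypothesis oU : open U.
Hypothesis U0 : U 0.

Lemma jet_eq k F G z : {in U, F =1 G} -> jet k F z = jet k G z.
Proof.
elim: k F G => [|k IH] F G FG /=; first by apply: FG; rewrite inE.
congr (_ * _); apply: eq_bigr => j _; congr (_ * _).
by apply: IH => x /[!inE] Ux; exact: open_eq_derive FG.
Qed.

Lemma flat_eq K F G : {in U, F =1 G} -> flat K F -> flat K G.
Proof.
elim: K F G => [|K IH] F G FG [F0 DF]; split=> //.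
- by rewrite -FG ?inE.
- by rewrite -FG ?inE.
by move=> j; apply: IH (DF j) => x /[!inE] Ux; exact: open_eq_derive FG.
Qed.

Lemma smooth_diff F x : smooth_on U F -> U x -> differentiable F x.
Proof. by move=> /(_ 0%N) /Cn_diff; apply. Qed.

Lemma smooth_derive F j : smooth_on U F -> smooth_on U ('D_(unitvec j) F).
Proof. by move=> sF N; have [_] := sF N.+1; apply. Qed.

Lemma smooth_sum (I : Type) (r : seq I) (P : pred I) (F : I -> 'cV[R]_n -> R) :
  (forall i, P i -> smooth_on U (F i)) ->
  smooth_on U (fun x => \sum_(i <- r | P i) F i x).
Proof. by move=> sF N; apply: Cn_sum => // i Pi; exact: sF. Qed.

Lemma smoothM F G : smooth_on U F -> smooth_on U G ->
  smooth_on U (fun x => F x * G x).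
Proof. by move=> sF sG N; exact: Cn_mul. Qed.

Lemma smooth_cst c : smooth_on U (fun=> c).
Proof. by move=> N; exact: Cn_cst. Qed.

Lemma jetD k F G z : smooth_on U F -> smooth_on U G ->
  jet k (fun x => F x + G x) z = jet k F z + jet k G z.
Proof.
elim: k F G => [//|k IH] F G sF sG /=.
rewrite -mulrDr -big_split; congr (_ * _); apply: eq_bigr => j _ /=.
rewrite -mulrDr -IH; [|exact: smooth_derive..]; congr (_ * _).
apply: jet_eq => x /[!inE] Ux; apply: deriveD_fun; exact: smooth_diff.
Qed.

Lemma jet0 k z : jet k (fun=> 0) z = 0.
Proof. exact: flat_jet (leqnn k) (flat0 k). Qed.

Lemma jet_cst k c z : jet k (fun=> c) z = if k is 0 then c else 0.
Proof.
case: k => [//|k] /=; rewrite big1 ?mulr0// => j _.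
rewrite (_ : 'D_(unitvec j) _ = (fun=> 0)) ?jet0 ?mulr0//.
by apply/funext => x; rewrite derive_cst.
Qed.

Lemma jet_sum k (I : Type) (r : seq I) (P : pred I)
    (F : I -> 'cV[R]_n -> R) z : (forall i, P i -> smooth_on U (F i)) ->
  jet k (fun x => \sum_(i <- r | P i) F i x) z = \sum_(i <- r | P i) jet k (F i) z.
Proof.
move=> sF; elim: r => [|i r IH].
  rewrite big_nil -[RHS](jet0 k z); apply: jet_eq => x _.
  by rewrite big_nil.
rewrite big_cons; have [Pi|Pi] := boolP (P i).
  rewrite -IH -jetD; [|exact: sF|exact: smooth_sum].
  by apply: jet_eq => x _; rewrite big_cons Pi.
by rewrite -IH; apply: jet_eq => x _; rewrite big_cons (negPf Pi).
Qed.

(** Leibniz: both sides satisfy the recursion [jetS] for the product, because the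
weight [k + 1] splits as [i + (k + 1 - i)] over the two factors. *)
Lemma jetM k F G z : smooth_on U F -> smooth_on U G ->
  jet k (fun x => F x * G x) z = \sum_(i < k.+1) jet i F z * jet (k - i) G z.
Proof.
elim: k F G => [|k IH] F G sF sG; first by rewrite big_ord1.
have k0 : k.+1%:R != 0 :> R by rewrite pnatr_eq0.
apply: (mulfI k0); rewrite jetS.
transitivity (\sum_(j < n) z j 0 *
   (\sum_(i < k.+1) jet i ('D_(unitvec j) F) z * jet (k - i) G z
   + \sum_(i < k.+1) jet i F z * jet (k - i) ('D_(unitvec j) G) z)).
  apply: eq_bigr => j _; congr (_ * _).
  rewrite -!IH//; try exact: smooth_derive.
  rewrite -jetD; try by apply: smoothM => //; exact: smooth_derive.
  apply: jet_eq => x /[!inE] Ux; apply: deriveM_fun; exact: smooth_diff.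
transitivity (\sum_(i < k.+1) i.+1%:R * jet i.+1 F z * jet (k - i) G z +
   \sum_(i < k.+1) jet i F z * ((k - i).+1%:R * jet (k - i).+1 G z)).
  under eq_bigr do rewrite mulrDr !mulr_sumr.
  rewrite big_split /=; congr (_ + _); rewrite exchange_big.
    apply: eq_bigr => i _; rewrite jetS mulr_suml.
    by apply: eq_bigr => j _; rewrite mulrA.
  apply: eq_bigr => i _; rewrite jetS mulr_sumr.
  by apply: eq_bigr => j _; rewrite mulrCA.
transitivity (\sum_(i < k.+2) i%:R * jet i F z * jet (k.+1 - i) G z +
   \sum_(i < k.+2) jet i F z * ((k.+1 - i)%:R * jet (k.+1 - i) G z)).
  congr (_ + _).
    by rewrite [RHS]big_ord_recl /= !mul0r add0r.
  rewrite [RHS]big_ord_recr /= subnn mul0r mulr0 addr0.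
  by apply: eq_bigr => i _; rewrite subSn// -ltnS.
rewrite -big_split mulr_sumr; apply: eq_bigr => i _ /=.
rewrite mulrCA [LHS]addrC -!mulrA -mulrDl -natrD subnK//.
by rewrite -ltnS.
Qed.

Lemma jet_coord k i z : jet k (fun x => x i 0) z = (k == 1)%:R * z i 0.
Proof.
case: k => [|k]; first by rewrite /= mxE mul0r.
apply: (mulfI (_ : k.+1%:R != 0)); first by rewrite pnatr_eq0.
rewrite jetS.
have E k' j : jet k' ('D_(unitvec j) (fun x : 'cV[R]_n => x i 0)) z =
    if k' is 0 then (i == j)%:R else 0.
  by rewrite -(jet_cst _ _ z); apply: jet_eq => x _; exact: derive_coord.
under eq_bigr do rewrite E.
case: k => [|k]; last by rewrite mul0r mulr0 big1// => j _; rewrite mulr0.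
rewrite mul1r (bigD1 i)//= eqxx mulr1 big1 ?addr0 ?mul1r// => j /negPf.
by rewrite eq_sym => ->; rewrite mulr0.
Qed.

(** The product rule applied to each summand [z j 0 * jet k ('D_j F) z]. *)
Lemma jet_derive_rec k F z (v : 'I_n) :
  k.+1%:R * 'D_(unitvec v) (jet k.+1 F) z = jet k ('D_(unitvec v) F) z +
    \sum_(j < n) z j 0 * 'D_(unitvec v) (jet k ('D_(unitvec j) F)) z.
Proof.
have dc (j : 'I_n) : differentiable (fun x : 'cV[R]_n => x j 0) z.
  exact: differentiable_coord.
have dt k' G : differentiable (jet k' G) z by exact: jet_differentiable.
have dcst (c : R) : differentiable (fun _ : 'cV[R]_n => c) z.
  exact: differentiable_cst.
transitivity ('D_(unitvec v) (fun x => k.+1%:R * jet k.+1 F x) z).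
  by rewrite (deriveM_fun _ (dcst _) (dt _ _)) derive_cst mul0r add0r.
rewrite (_ : (fun x => _) =
    \sum_(j < n) (fun x => x j 0 * jet k ('D_(unitvec j) F) x)); last first.
  by apply/funext => x; rewrite jetS fct_sumE.
rewrite derive_sum => [|j]; last first.
  exact/diff_derivable/(differentiableM (dc j) (dt _ _)).
under eq_bigr => j _ do rewrite (deriveM_fun _ (dc j) (dt _ _)) derive_coord.
rewrite big_split /=; congr (_ + _).
rewrite (bigD1 v)//= eqxx mul1r big1 ?addr0// => j /negPf ->.
by rewrite mul0r.
Qed.

(** Differentiating the polynomial of degree [k + 1] commutes with taking Taylor
parts. In the induction, symmetry of second derivatives turns the remaining
sum into [k + 1] times the right-hand side, as in Euler's identity for
homogeneous polynomials. *)
Lemma jet_derive k F z (v : 'I_n) : smooth_on U F ->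
  'D_(unitvec v) (jet k.+1 F) z = jet k ('D_(unitvec v) F) z.
Proof.
elim: k F => [|k IH] F sF.
  have := jet_derive_rec 0 F z v; rewrite mul1r => ->.
  by rewrite big1 ?addr0// => j _; rewrite derive_cst mulr0.
have k0 : k.+2%:R != 0 :> R by rewrite pnatr_eq0.
apply: (mulfI k0); rewrite jet_derive_rec.
under eq_bigr => j _.
  rewrite IH; last exact: smooth_derive.
  have -> : jet k ('D_(unitvec v) ('D_(unitvec j) F)) z =
            jet k ('D_(unitvec j) ('D_(unitvec v) F)) z.
    apply: jet_eq => x /[!inE] Ux; apply: (derive_sym oU Ux).
    - by move=> y Uy; exact: smooth_diff sF Uy.
    - exact: smooth_diff (smooth_derive j sF) Ux.
    - exact: smooth_diff (smooth_derive v sF) Ux.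
  over.
by rewrite -jetS -[k.+2%:R]natr1 mulrDl mul1r addrC.
Qed.

(** If the polynomial [jet k.+1 F] is zero at every point, so are its derivatives,
which by [jet_derive] are the jets of the partial derivatives of [F]; the
induction hypothesis then makes these flat to one order less. *)
Lemma jet_flat K F : smooth_on U F ->
  (forall k z, (k <= K)%N -> jet k F z = 0) -> flat K F.
Proof.
elim: K F => [|K IH] F sF tF; split=> //; try exact: (tF 0%N 0).
move=> j; apply: IH => [|k z kK]; first exact: smooth_derive.
rewrite -jet_derive// (_ : jet k.+1 F = fun=> 0) ?derive_cst//.
by apply/funext => x; exact: tF.
Qed.

Lemma flat_add K F G : smooth_on U F -> smooth_on U G ->
  flat K F -> flat K G -> flat K (fun x => F x + G x).
Proof.
elim: K F G => [|K IH] F G sF sG [F0 DF] [G0 DG]; split=> //;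
  rewrite ?F0 ?G0 ?addr0// => j.
apply: flat_eq (IH _ _ _ _ (DF j) (DG j)); try exact: smooth_derive.
by move=> x /[!inE] Ux; rewrite deriveD_fun//; exact: smooth_diff.
Qed.

Lemma flat_mul K F G : smooth_on U F -> smooth_on U G ->
  flat K F -> flat K (fun x => F x * G x).
Proof.
elim: K F G => [|K IH] F G sF sG [F0 DF]; split=> //;
  rewrite ?F0 ?mul0r// => j.
have CF : flat K F by exact: (@flatW K F (conj F0 DF)).
have h1 := IH _ _ (smooth_derive j sF) sG (DF j).
have h2 := IH _ _ sF (smooth_derive j sG) CF.
apply: flat_eq (flat_add _ _ h1 h2); try by apply: smoothM => //; exact: smooth_derive.
by move=> x /[!inE] Ux; rewrite deriveM_fun//; exact: smooth_diff.
Qed.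

Lemma flat_sum K (I : Type) (r : seq I) (F : I -> 'cV[R]_n -> R) :
  (forall i, smooth_on U (F i)) -> (forall i, flat K (F i)) ->
  flat K (fun x => \sum_(i <- r) F i x).
Proof.
move=> sF fF; elim: r => [|i r IH].
  by apply: flat_eq (flat0 K) => x _; rewrite big_nil.
apply: flat_eq (flat_add (sF i) _ (fF i) IH); last exact: smooth_sum.
by move=> x _; rewrite big_cons.
Qed.

End Tau.

(** The chain rule writes a partial derivative of [F \o Phi] as a sum of products
in which one factor is a composite [('D_i F) \o Phi], flat to one order less
than [F] by induction. *)
Lemma flat_comp (R : realType) (n p : nat) (U : set 'cV[R]_n)
    (W : set 'cV[R]_p) (Phi : 'cV[R]_n -> 'cV[R]_p) (F : 'cV[R]_p -> R) K :
  open U -> U 0 -> (forall x, U x -> W (Phi x)) -> Phi 0 = 0 ->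
  (forall i, smooth_on U (fun x => Phi x i 0)) -> smooth_on W F ->
  flat K F -> flat K (F \o Phi).
Proof.
move=> oU U0 UW P0 sP; elim: K F => [|K IH] F sF fF.
  by split=> //=; rewrite P0; case: fF.
split; first by rewrite /= P0; case: fF.
move=> j; have dP x : U x -> differentiable Phi x.
  by move=> Ux; apply: differentiable_mx => i k; rewrite ord1; exact: smooth_diff (sP i) Ux.
apply: (@flat_eq _ _ U oU U0 _ (fun x => \sum_i ('D_(unitvec i) F \o Phi) x *
    'D_(unitvec j) (fun y => Phi y i 0) x)).
  move=> x /[!inE] Ux; rewrite derive_comp_cV//; first exact: dP.
  exact: smooth_diff sF (UW _ Ux).
have sFP i : smooth_on U ('D_(unitvec i) F \o Phi).
  by move=> N; apply: (Cn_comp (W := W)) => //; [move=> k; exact: sP|exact: smooth_derive].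
apply: (flat_sum oU U0) => i; first by apply: smoothM => //; exact: smooth_derive.
apply: (flat_mul oU U0) => //; first exact: smooth_derive.
apply: IH; [exact: smooth_derive|exact: fF.2].
Qed.

(** * Taylor parts of matrix-valued functions *)

Section Partials.
Context {R : realType} {n : nat}.

Lemma partials_rcons (V : normedModType R) (F : 'cV[R]_n -> V) s j :
  partials (rcons s j) F = partials s ('D_(unitvec j) F).
Proof. by rewrite /partials foldr_rcons. Qed.

(** A derivative with index list [s] of ['D_j F] is the derivative of [F] with
index list [rcons s j]. *)
Lemma smooth_onP (U : set 'cV[R]_n) (F : 'cV[R]_n -> R) :
  smooth_on U F <-> forall s x, U x -> differentiable (partials s F) x.
Proof.
split=> [sF s|dF N].
  elim/last_ind: s F sF => [|s j IH] F sF x Ux; first exact: smooth_diff Ux.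
  by rewrite partials_rcons; apply: IH => //; exact: smooth_derive.
elim: N F dF => [|N IH] F dF; split=> //; try exact: (dF [::]).
by move=> j; apply: IH => s x Ux; rewrite -partials_rcons; exact: dF.
Qed.

Lemma partials_entries (U : set 'cV[R]_n) (a b : nat)
    (M : 'cV[R]_n -> 'M[R]_(a, b)) : open U ->
  (forall s x, U x -> differentiable (partials s M) x) ->
  forall i j s x, U x -> partials s M x i j = partials s (fun y => M y i j) x.
Proof.
move=> oU dM i j; elim=> [//|k s IH] x Ux /=.
rewrite derive_entry; last exact: dM.
by apply: (open_eq_derive _ oU Ux) => y /[!inE]; exact: IH.
Qed.

Definition smooth_mx (U : set 'cV[R]_n) (a b : nat)
    (M : 'cV[R]_n -> 'M[R]_(a, b)) :=
  forall i j, smooth_on U (fun x => M x i j).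

Lemma partials_mx (U : set 'cV[R]_n) (a b : nat)
    (M : 'cV[R]_n -> 'M[R]_(a, b)) : open U -> smooth_mx U M ->
  forall s x, U x -> 
    partials s M x = \matrix_(i, j) partials s (fun y => M y i j) x.
Proof.
move=> oU sM; elim=> [|k s IH] x Ux /=; first by apply/matrixP => i j; rewrite !mxE.
pose G y := \matrix_(i, j) partials s (fun y => M y i j) y.
have dG : differentiable G x.
  apply: differentiable_mx => i j.
  rewrite (_ : (fun y => _) = partials s (fun y => M y i j)).
    exact: (smooth_onP U _).1.
  by apply/funext => y; rewrite mxE.
apply/matrixP => i j; rewrite mxE.
transitivity ('D_(unitvec k) G x i j).
  congr (fun_of_matrix _ i j); apply: near_eq_derive.
  have : nbhs x U by exact: open_nbhs_nbhs.
  by apply: filterS => y; exact: IH.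
rewrite derive_entry//; congr ('D_(unitvec k) _ x).
by apply/funext => y; rewrite mxE.
Qed.

Lemma partials_mx_differentiable (U : set 'cV[R]_n) (a b : nat)
    (M : 'cV[R]_n -> 'M[R]_(a, b)) : open U -> smooth_mx U M ->
  forall s x, U x -> differentiable (partials s M) x.
Proof.
move=> oU sM s x Ux; apply: (@open_eq_differentiable _ _ _
  (fun y => \matrix_(i, j) partials s (fun y => M y i j) y) _ U) => //.
  by move=> y /[!inE] Uy; rewrite (partials_mx oU sM).
apply: differentiable_mx => i j.
rewrite (_ : (fun y => _) = partials s (fun y => M y i j)).
  exact: (smooth_onP U _).1.
by apply/funext => y; rewrite mxE.
Qed.

(** The last index of a tuple is the innermost derivative, the one that the
recursion of [jet] peels off; hence the sum over [k.+1]-tuples is split at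
their last entry. *)
Lemma taylor_part_scalar (F : 'cV[R]_n -> R) k z :
  taylor_part F k z = jet k F z.
Proof.
suff E : \sum_(s : k.-tuple 'I_n) (\prod_(j <- s) z j 0) * partials s F 0 =
    k`!%:R * jet k F z.
  by rewrite /taylor_part [X in _ *: X]E [LHS]mulKf// pnatr_eq0 -lt0n fact_gt0.
elim: k F => [|k IH] F.
  rewrite fact0 mul1r (big_pred1 [tuple]) /= ?big_nil ?mul1r// => t.
  by apply/esym/eqP/val_inj; case: t => [[]].
rewrite factS natrM mulrAC jetS.
pose h (p : 'I_n * k.-tuple 'I_n) := [tuple of rcons p.2 p.1].
rewrite (reindex h); last first.
  apply: onW_bij; apply: inj_card_bij; last first.
    by rewrite card_prod !card_tuple !card_ord expnS.
  by move=> [j t] [j' t'] /(congr1 val) /= /rcons_inj[/val_inj -> ->].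
transitivity (\sum_(j < n) \sum_(t : k.-tuple 'I_n)
    (\prod_(i <- rcons t j) z i 0) * partials (rcons t j) F 0).
  by rewrite pair_bigA.
rewrite mulr_suml; apply: eq_bigr => j _.
rewrite mulrAC -mulrA -IH mulr_sumr; apply: eq_bigr => t _.
by rewrite partials_rcons -cats1 big_cat big_seq1 mulrCA mulrA.
Qed.

Definition jetmx k (a b : nat) (M : 'cV[R]_n -> 'M[R]_(a, b)) (z : 'cV[R]_n) :=
  \matrix_(i, j) jet k (fun x => M x i j) z.

Lemma taylor_part_mx (U : set 'cV[R]_n) (a b : nat)
    (M : 'cV[R]_n -> 'M[R]_(a, b)) k z : open U -> U 0 ->
  (forall i j s x, U x -> partials s M x i j = partials s (fun y => M y i j) x) ->
  taylor_part M k z = jetmx k M z.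
Proof.
move=> oU U0 dM; apply/matrixP => i j; rewrite !mxE -taylor_part_scalar.
rewrite /taylor_part; congr (_ * _); rewrite summxE; apply: eq_bigr => s _.
by rewrite mxE dM.
Qed.

Lemma smooth_near0_mx (a b : nat) (M : 'cV[R]_n -> 'M[R]_(a, b)) :
  smooth_near0 M -> exists U : set 'cV[R]_n, [/\ open U, U 0, smooth_mx U M &
    forall k z, taylor_part M k z = jetmx k M z].
Proof.
rewrite /smooth_near0 -nbhs_nearE nbhsE => -[U [oU U0] UM].
have dM s x : U x -> differentiable (partials s M) x by move=> /UM.
have E := partials_entries oU dM.
exists U; split=> // [i j|k z]; last exact: taylor_part_mx E.
apply/smooth_onP => s x Ux.
apply: (@open_eq_differentiable _ _ _ (fun y => partials s M y i j) _ U) => //.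
  by move=> y /[!inE]; exact: E.
exact/differentiable_entry/dM.
Qed.

Lemma smooth_mx_near0 (U : set 'cV[R]_n) (a b : nat)
    (M : 'cV[R]_n -> 'M[R]_(a, b)) : open U -> U 0 -> smooth_mx U M ->
  smooth_near0 M /\ forall k z, taylor_part M k z = jetmx k M z.
Proof.
move=> oU U0 sM; split=> [|k z].
  have : nbhs (0 : 'cV[R]_n) U by exact: open_nbhs_nbhs.
  by apply: filterS => x Ux s; exact: partials_mx_differentiable Ux.
apply: (taylor_part_mx _ _ oU U0) => i j s x Ux.
by rewrite (partials_mx oU sM) // mxE.
Qed.

End Partials.

(** * Kronecker powers and the Lyapunov matrix *)

Section Hetero.
Context {R : realType}.

(** Equality of matrices whose dimensions agree only propositionally. Working up
to [meq] lets Kronecker identities such as associativity be composed without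
transporting along equations between products of powers; [meqP] returns to
ordinary equality. *)
Definition meq {a b c d : nat} (A : 'M[R]_(a, b)) (B : 'M[R]_(c, d)) : Prop :=
  exists e : ((a = c) * (b = d))%type, castmx e A = B.

Lemma meq_refl a b (A : 'M[R]_(a, b)) : meq A A.
Proof. by exists (erefl, erefl); rewrite castmx_id. Qed.

Lemma meq_sym a b c d (A : 'M[R]_(a, b)) (B : 'M[R]_(c, d)) :
  meq A B -> meq B A.
Proof.
by move=> [[e f] <-]; subst c d; rewrite castmx_id; exact: meq_refl.
Qed.

Lemma meq_trans a b c d a' b' (A : 'M[R]_(a, b)) (B : 'M[R]_(c, d))
  (C : 'M[R]_(a', b')) : meq A B -> meq B C -> meq A C.
Proof. by move=> [[e f] <-]; subst c d; rewrite castmx_id. Qed.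

Lemma meqP a b (A B : 'M[R]_(a, b)) : meq A B -> A = B.
Proof. by case=> e <-; rewrite castmx_id. Qed.

Lemma meq_cast a b c d (e : (a = c) * (b = d)) (A : 'M[R]_(a, b)) :
  meq (castmx e A) A.
Proof. by apply: meq_sym; exists e. Qed.

Lemma meq_recast a b c d (A : 'M[R]_(a, b)) :
  a = c -> b = d -> meq (recast c d A) A.
Proof. by move=> e f; rewrite (recastE (e, f)); exact: meq_cast. Qed.

Lemma meq_tens a b c d a' b' c' d' (A : 'M[R]_(a, b)) (A' : 'M[R]_(a', b'))
    (B : 'M[R]_(c, d)) (B' : 'M[R]_(c', d')) :
  meq A A' -> meq B B' -> meq (A *t B) (A' *t B').
Proof.
move=> [[e f] <-] [[e' f'] <-]; subst a' b' c' d'.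
by rewrite !castmx_id; exact: meq_refl.
Qed.

Lemma meq_mul a b c a' b' c' (A : 'M[R]_(a, b)) (A' : 'M[R]_(a', b'))
    (B : 'M[R]_(b, c)) (B' : 'M[R]_(b', c')) :
  meq A A' -> meq B B' -> meq (A *m B) (A' *m B').
Proof.
move=> [[e f] <-] [[e' f'] <-]; subst a' b' c'.
by rewrite !castmx_id; exact: meq_refl.
Qed.

(** On indices, [(i0, (i1, i2))] and [((i0, i1), i2)] have the same numerical
value. *)
Lemma meq_tensA a b c d p q (A : 'M[R]_(a, b)) (B : 'M[R]_(c, d))
    (C : 'M[R]_(p, q)) : meq (A *t B *t C) (A *t (B *t C)).
Proof.
exists (esym (mulnA _ _ _), esym (mulnA _ _ _)); apply/matrixP => i j.
case: (mxtens_indexP i) => i0 i'; case: (mxtens_indexP i') => i1 i2.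
case: (mxtens_indexP j) => j0 j'; case: (mxtens_indexP j') => j1 j2.
rewrite castmxE !tensmxE mulrA -!tensmxE /=.
congr (fun_of_matrix _ _ _); apply: val_inj => /=;
  by rewrite mulnDl mulnA addnA.
Qed.

Lemma meq_1tens a b (A : 'M[R]_(a, b)) : meq ((1%:M : 'M[R]_1) *t A) A.
Proof. by rewrite (tens_scalar1mx A); exact: meq_cast. Qed.

Lemma meq_tens1 a b (A : 'M[R]_(a, b)) : meq (A *t (1%:M : 'M[R]_1)) A.
Proof. by rewrite tens_mx_scalar scale1r; exact: meq_cast. Qed.

Lemma meq_ntensS a b (A : 'M[R]_(a, b)) k :
  meq (ntensmx A k.+1) (A *t ntensmx A k).
Proof.
case: k => [|k]; last exact: meq_refl.
by apply: meq_sym; exact: meq_tens1.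
Qed.

Lemma meq_ntensD a b (A : 'M[R]_(a, b)) k l :
  meq (ntensmx A (k + l)) (ntensmx A k *t ntensmx A l).
Proof.
elim: k => [|k IH]; first exact/meq_sym/meq_1tens.
apply: meq_trans (meq_ntensS _ _) _.
apply: meq_trans (meq_tens (meq_refl _) IH) _.
apply: meq_trans (meq_sym (meq_tensA _ _ _)) _.
exact: meq_tens (meq_sym (meq_ntensS _ _)) (meq_refl _).
Qed.

Lemma meq_kpow n (x : 'cV[R]_n) k : meq (kpow x k) (ntensmx x k).
Proof. exact: meq_cast. Qed.

Lemma meq_kpowD n (x : 'cV[R]_n) k l :
  meq (kpow x (k + l)) (kpow x k *t kpow x l).
Proof.
apply: meq_trans (meq_kpow _ _) _; apply: meq_trans (meq_ntensD _ _ _) _.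
by apply: meq_tens; exact/meq_sym/meq_kpow.
Qed.

Lemma kpowS n (x : 'cV[R]_n) k :
  kpow x k.+1 = castmx (esym (expnS n k), muln1 1) (x *t kpow x k).
Proof.
apply: meqP; apply: meq_trans (meq_kpow _ _) _.
apply: meq_trans (meq_ntensS _ _) _; apply: meq_trans (meq_sym (meq_cast _ _)).
by apply: meq_tens; [exact: meq_refl|exact/meq_sym/meq_kpow].
Qed.

Lemma tens11 a b : (1%:M : 'M[R]_a) *t (1%:M : 'M[R]_b) = 1%:M.
Proof.
apply/matrixP => i j.
case: (mxtens_indexP i) => i0 i1; case: (mxtens_indexP j) => j0 j1.
by rewrite tensmxE !mxE (can_eq (@mxtens_indexK a b)) -natrM mulnb.
Qed.

Lemma meq_1 a b : a = b -> meq (1%:M : 'M[R]_a) (1%:M : 'M[R]_b).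
Proof. by move=> <-; exact: meq_refl. Qed.

Lemma ntens1 n k : ntensmx (1%:M : 'M[R]_n) k = 1%:M.
Proof.
elim: k => [//|k IH]; apply: meqP; apply: meq_trans (meq_ntensS _ _) _.
by rewrite IH tens11; apply: meq_1; rewrite expnS.
Qed.

Lemma recast_sum a b c d (I : Type) (r : seq I) (P : pred I)
    (A : I -> 'M[R]_(a, b)) : a = c -> b = d ->
  recast c d (\sum_(i <- r | P i) A i) = \sum_(i <- r | P i) recast c d (A i).
Proof.
move=> e f; subst c d.
by rewrite /recast conform_mx_id; under [RHS]eq_bigr do rewrite conform_mx_id.
Qed.

Lemma recast_recast a b c d c' d' (A : 'M[R]_(a, b)) : a = c -> b = d ->
  recast c' d' (recast c d A) = recast c' d' A.
Proof. by move=> e f; subst c d; rewrite /recast conform_mx_id. Qed.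

Lemma castmxD a b c d (e : (a = c) * (b = d)) (A B : 'M[R]_(a, b)) :
  castmx e (A + B) = castmx e A + castmx e B.
Proof. by case: e => e f; subst c d; rewrite !castmx_id. Qed.

Lemma castmx_sum a b c d (e : (a = c) * (b = d)) (I : Type) (r : seq I)
    (P : pred I) (A : I -> 'M[R]_(a, b)) :
  castmx e (\sum_(i <- r | P i) A i) = \sum_(i <- r | P i) castmx e (A i).
Proof.
case: e => e f; subst c d; rewrite castmx_id.
by apply: eq_bigr => i _; rewrite castmx_id.
Qed.

Lemma tensmx_sumr a b c d (A : 'M[R]_(a, b)) (I : Type) (r : seq I)
    (P : pred I) (B : I -> 'M[R]_(c, d)) :
  A *t (\sum_(i <- r | P i) B i) = \sum_(i <- r | P i) A *t B i.
Proof.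
apply/matrixP => i j; rewrite !mxE !summxE mulr_sumr.
by apply: eq_bigr => k _; rewrite mxE.
Qed.

(** The derivative of [x |-> kpow x k] at [z] in the direction [v], in the form
given by the product rule for [x *t kpow x k']; see [jac_kpow]. *)
Fixpoint kpow_dir n (z v : 'cV[R]_n) k : 'cV[R]_(n ^ k) :=
  if k is k'.+1 then
    castmx (esym (expnS n k'), muln1 1) (v *t kpow z k' + z *t kpow_dir z v k')
  else 0.

Lemma kpow_dirE n (z v : 'cV[R]_n) k : kpow_dir z v k =
  \sum_(0 <= l < k) recast (n ^ k) 1 (kpow z l *t (v *t kpow z (k.-1 - l))).
Proof.
elim: k => [|k IH] /=; first by rewrite big_nil.
rewrite big_nat_recl//= subn0 castmxD; congr (_ + _).
  apply: meqP; apply: meq_trans (meq_cast _ _) _; apply: meq_sym.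
  apply: meq_trans (meq_recast _ _ _) _; rewrite ?expn0 ?mul1n ?expnS//.
  rewrite (_ : kpow z 0 = 1%:M); first exact: meq_1tens.
  by apply: meqP; apply: meq_trans (meq_kpow _ _) _; exact: meq_refl.
rewrite IH tensmx_sumr castmx_sum; apply: eq_big_nat => l /andP[_ lk].
have E1 : (n ^ l * (n * n ^ (k.-1 - l)) = n ^ k)%N by exact: lyap_index_rows.
have E2 : (n ^ l.+1 * (n * n ^ (k - l.+1)) = n ^ k.+1)%N by exact: (@lyap_index_rows n k.+1 l.+1).
apply: meqP; apply: meq_trans (meq_cast _ _) _.
apply: meq_trans (meq_tens (meq_refl _) (meq_recast _ E1 _)) _ => //.
apply: meq_sym; apply: meq_trans (meq_recast _ E2 _) _ => //.
rewrite kpowS (_ : (k - l.+1)%N = (k.-1 - l)%N); last by lia.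
apply: meq_trans (meq_tens (meq_cast _ _) (meq_refl _)) _.
exact: meq_tensA.
Qed.

(** By the mixed product rule the summand of [lyap i W] with [W] in position [l]
sends [kpow z l *t (kpow z q *t kpow z (i.-1 - l))] to
[kpow z l *t (W *m kpow z q *t kpow z (i.-1 - l))], since the other factors
are identity matrices. *)
Lemma lyap_kpow n q i k (W : 'M[R]_(n, n ^ q)) (z : 'cV[R]_n) :
  (0 < i)%N -> (i.-1 + q = k)%N ->
  recast (n ^ i) (n ^ k) (lyap i W) *m kpow z k = kpow_dir z (W *m kpow z q) i.
Proof.
move=> i0 ik; have dk : (n ^ i.-1 * n ^ q = n ^ k)%N by rewrite -expnD ik.
rewrite kpow_dirE /lyap recast_sum// mulmx_suml; apply: eq_big_nat => l /andP[_ li].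
have E1 : (n ^ l * (n * n ^ (i.-1 - l)) = n ^ i)%N by exact: lyap_index_rows.
have E2 : (n ^ l * (n ^ q * n ^ (i.-1 - l)) = n ^ i.-1 * n ^ q)%N.
  exact: lyap_index_cols.
rewrite recast_recast//; apply: meqP.
apply: meq_trans _ (meq_sym (meq_recast _ _ _)) => //.
have kE : k = (l + (q + (i.-1 - l)))%N by lia.
have zE : meq (kpow z k) (kpow z l *t (kpow z q *t kpow z (i.-1 - l))).
  rewrite kE; apply: meq_trans (meq_kpowD _ _ _) _.
  by apply: meq_tens; [exact: meq_refl|exact: meq_kpowD].
apply: meq_trans (meq_mul (meq_recast _ E1 _) zE) _; first by rewrite E2.
rewrite tensmx_mul tensmx_mul !ntens1 !mul1mx; exact: meq_refl.
Qed.

End Hetero.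

(** * Jets of matrix-valued functions *)

Section Jets.
Context {R : realType} {n : nat}.
Variable U : set 'cV[R]_n.
Hypothesis oU : open U.
Hypothesis U0 : U 0.

Lemma jetmx_eq k a b (A B : 'cV[R]_n -> 'M[R]_(a, b)) z :
  {in U, A =1 B} -> jetmx k A z = jetmx k B z.
Proof.
move=> AB; apply/matrixP => i j; rewrite !mxE; apply: (jet_eq oU U0) => x Ux.
by rewrite AB.
Qed.

Lemma smooth_mxM a b c (A : 'cV[R]_n -> 'M[R]_(a, b))
    (B : 'cV[R]_n -> 'M[R]_(b, c)) : smooth_mx U A -> smooth_mx U B ->
  smooth_mx U (fun x => A x *m B x).
Proof.
move=> sA sB i j.
rewrite (_ : (fun x => _) = fun x => \sum_l A x i l * B x l j).
  by apply: smooth_sum => // l _; exact: smoothM.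
by apply/funext => x; rewrite mxE.
Qed.

Lemma jetmxM k a b c (A : 'cV[R]_n -> 'M[R]_(a, b))
    (B : 'cV[R]_n -> 'M[R]_(b, c)) z : smooth_mx U A -> smooth_mx U B ->
  jetmx k (fun x => A x *m B x) z = \sum_(i < k.+1) jetmx i A z *m jetmx (k - i) B z.
Proof.
move=> sA sB; apply/matrixP => i j; rewrite mxE summxE.
rewrite (_ : (fun x => _) = fun x => \sum_l A x i l * B x l j); last first.
  by apply/funext => x; rewrite mxE.
rewrite (jet_sum oU U0) => [|l _]; last exact: smoothM.
transitivity (\sum_l \sum_(p < k.+1) jetmx p A z i l * jetmx (k - p) B z l j).
  apply: eq_bigr => l _; rewrite (jetM oU U0)//.
  by apply: eq_bigr => p _; rewrite !mxE.
by rewrite exchange_big; apply: eq_bigr => p _; rewrite mxE.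
Qed.

Lemma smooth_mx_tens a b c d (A : 'cV[R]_n -> 'M[R]_(a, b))
    (B : 'cV[R]_n -> 'M[R]_(c, d)) : smooth_mx U A -> smooth_mx U B ->
  smooth_mx U (fun x => A x *t B x).
Proof.
move=> sA sB i j; rewrite (_ : (fun x => _) =
  fun x => A x (mxtens_unindex i).1 (mxtens_unindex j).1 *
           B x (mxtens_unindex i).2 (mxtens_unindex j).2); first exact: smoothM.
by apply/funext => x; rewrite mxE.
Qed.

Lemma jetmx_tens k a b c d (A : 'cV[R]_n -> 'M[R]_(a, b))
    (B : 'cV[R]_n -> 'M[R]_(c, d)) z : smooth_mx U A -> smooth_mx U B ->
  jetmx k (fun x => A x *t B x) z = \sum_(i < k.+1) jetmx i A z *t jetmx (k - i) B z.
Proof.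
move=> sA sB; apply/matrixP => i j; rewrite mxE summxE.
rewrite (_ : (fun x => _) =
  fun x => A x (mxtens_unindex i).1 (mxtens_unindex j).1 *
           B x (mxtens_unindex i).2 (mxtens_unindex j).2); last first.
  by apply/funext => x; rewrite mxE.
by rewrite (jetM oU U0)//; apply: eq_bigr => p _; rewrite !mxE.
Qed.

Lemma smooth_mx_cst a b (A : 'M[R]_(a, b)) : smooth_mx U (fun=> A).
Proof. by move=> i j; exact: smooth_cst. Qed.

Lemma jetmx_cst k a b (A : 'M[R]_(a, b)) (z : 'cV[R]_n) :
  jetmx k (fun=> A) z = if k is 0 then A else 0.
Proof.
by apply/matrixP => i j; rewrite mxE jet_cst; case: k => [//|k]; rewrite mxE.
Qed.

Lemma jetmx_cstM k a b c (A : 'M[R]_(a, b)) (B : 'cV[R]_n -> 'M[R]_(b, c)) z :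
  smooth_mx U B -> jetmx k (fun x => A *m B x) z = A *m jetmx k B z.
Proof.
move=> sB; rewrite (jetmxM _ _ (smooth_mx_cst A) sB) big_ord_recl jetmx_cst subn0.
by rewrite big1 ?addr0// => i _; rewrite jetmx_cst mul0mx.
Qed.

Lemma smooth_mx_cast a b c d (e : (a = c) * (b = d))
    (A : 'cV[R]_n -> 'M[R]_(a, b)) :
  smooth_mx U A -> smooth_mx U (fun x => castmx e (A x)).
Proof.
move=> sA i j; rewrite (_ : (fun x => _) =
  fun x => A x (cast_ord (esym e.1) i) (cast_ord (esym e.2) j)); first exact: sA.
by apply/funext => x; rewrite castmxE.
Qed.

Lemma jetmx_cast k a b c d (e : (a = c) * (b = d))
    (A : 'cV[R]_n -> 'M[R]_(a, b)) z :
  jetmx k (fun x => castmx e (A x)) z = castmx e (jetmx k A z).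
Proof.
case: e => e f; subst c d; rewrite castmx_id; congr (jetmx k _ z).
Qed.

Lemma smooth_mx_sum a b (I : Type) (r : seq I) (P : pred I)
    (A : I -> 'cV[R]_n -> 'M[R]_(a, b)) : (forall i, P i -> smooth_mx U (A i)) ->
  smooth_mx U (fun x => \sum_(i <- r | P i) A i x).
Proof.
move=> sA i j.
rewrite (_ : (fun x => _) = fun x => \sum_(l <- r | P l) A l x i j).
  by apply: smooth_sum => // l Pl; exact: sA.
by apply/funext => x; rewrite summxE.
Qed.

Lemma jetmx_sum k a b (I : Type) (r : seq I) (P : pred I)
    (A : I -> 'cV[R]_n -> 'M[R]_(a, b)) z : (forall i, P i -> smooth_mx U (A i)) ->
  jetmx k (fun x => \sum_(i <- r | P i) A i x) z = \sum_(i <- r | P i) jetmx k (A i) z.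
Proof.
move=> sA; apply/matrixP => i j; rewrite mxE summxE.
rewrite (_ : (fun x => _) = fun x => \sum_(l <- r | P l) A l x i j); last first.
  by apply/funext => x; rewrite summxE.
rewrite (jet_sum oU U0) => [|l Pl]; last exact: sA.
by apply: eq_bigr => l _; rewrite mxE.
Qed.

Lemma jetmxD k a b (A B : 'cV[R]_n -> 'M[R]_(a, b)) z :
  smooth_mx U A -> smooth_mx U B ->
  jetmx k (fun x => A x + B x) z = jetmx k A z + jetmx k B z.
Proof.
move=> sA sB; apply/matrixP => i j; rewrite !mxE -(jetD oU U0)//.
by congr (jet k _ z); apply/funext => x; rewrite mxE.
Qed.

Lemma smooth_mxD a b (A B : 'cV[R]_n -> 'M[R]_(a, b)) :
  smooth_mx U A -> smooth_mx U B -> smooth_mx U (fun x => A x + B x).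
Proof.
move=> sA sB i j.
rewrite (_ : (fun x => _) = fun x => A x i j + B x i j).
  by move=> N; apply: Cn_add => //; [exact: sA|exact: sB].
by apply/funext => x; rewrite mxE.
Qed.

Lemma smooth_mx_kpow p (P : 'cV[R]_n -> 'cV[R]_p) j :
  smooth_mx U P -> smooth_mx U (fun x => kpow (P x) j).
Proof.
move=> sP; elim: j => [|j IH]; first exact: (smooth_mx_cst (kpow (0 : 'cV[R]_p) 0)).
rewrite (_ : (fun x => _) = fun x =>
  castmx (esym (expnS p j), muln1 1) (P x *t kpow (P x) j)).
  exact/smooth_mx_cast/smooth_mx_tens.
by apply/funext => x; rewrite kpowS.
Qed.

Lemma jetmx_kpowS k p (P : 'cV[R]_n -> 'cV[R]_p) j z : smooth_mx U P ->
  jetmx k (fun x => kpow (P x) j.+1) z =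
  castmx (esym (expnS p j), muln1 1)
    (\sum_(i < k.+1) jetmx i P z *t jetmx (k - i) (fun x => kpow (P x) j) z).
Proof.
move=> sP; rewrite -jetmx_tens//; last exact: smooth_mx_kpow.
rewrite -jetmx_cast; congr (jetmx k _ z).
by apply/funext => x; rewrite kpowS.
Qed.

Lemma jetmx_id k (z : 'cV[R]_n) : jetmx k id z = (k == 1)%:R *: z.
Proof.
by apply/matrixP => i j; rewrite !mxE ord1; exact: (jet_coord oU U0).
Qed.

Lemma smooth_mx_id : smooth_mx U id.
Proof. by move=> i j N; rewrite ord1; exact: Cn_coord. Qed.

(** The entries of [kpow x j] are monomials of degree [j]. *)
Lemma jetmx_kpow k j (z : 'cV[R]_n) :
  jetmx k (fun x => kpow x j) z = (k == j)%:R *: kpow z j.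
Proof.
elim: j k => [|j IH] k.
  by rewrite (jetmx_cst k (kpow z 0)); case: k => [|k]; rewrite ?scale1r ?scale0r.
rewrite (jetmx_kpowS k j z smooth_mx_id) kpowS.
under eq_bigr do rewrite jetmx_id IH.
case: k => [|k].
  rewrite big_ord1 scale0r tens0mx scale0r.
  by apply/matrixP => a b; rewrite castmxE !mxE.
rewrite 2!big_ord_recl big1 ?addr0 => [|i _]; last by rewrite scale0r tens0mx.
rewrite scale0r tens0mx add0r scale1r subSS subn0 eqSS.
by case: eqP => _; [rewrite !scale1r|rewrite !scale0r tensmx0;
  apply/matrixP => a b; rewrite castmxE !mxE].
Qed.

(** The degree [k] part of a Kronecker power of [P] sums, over all ways to
distribute the degree among the factors, the products of the parts of [P];
a factor of degree 0 contributes nothing, so only tuples of positive integers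
remain. *)
Lemma jetmx_Tcal k (P : 'cV[R]_n -> 'cV[R]_n) (T : forall k, 'M[R]_(n, n ^ k)) j z :
  smooth_mx U P -> jetmx 0 P z = 0 ->
  (forall i, (0 < i)%N -> jetmx i P z = T i *m kpow z i) ->
  jetmx k (fun x => kpow (P x) j) z = Tcal T j k *m kpow z k.
Proof.
move=> sP P0 PT; rewrite /Tcal mulmx_suml.
(* The bound on the entries of the tuples in [Tcal] depends on [k], while the
   recursion lowers [k]; any larger bound gives the same sum, and it is kept
   fixed. *)
suff H N : (k < N)%N -> jetmx k (fun x => kpow (P x) j) z =
    \sum_(t : j.-tuple 'I_N | all (leq 1) (map val t) && (sumn (map val t) == k))
      recast (n ^ j) (n ^ k) (tprod T (map val t)) *m kpow z k by exact: H.
elim: j k => [|j IH] k kN.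
  rewrite (jetmx_cst k (kpow z 0)) big_mkcond (big_pred1 [tuple]) /=; last first.
    by move=> t; apply/esym/eqP/val_inj; case: t => [[]].
  case: k kN => [|k] kN //=.
  apply: meqP; apply: meq_sym; rewrite -[X in meq _ X]mul1mx.
  by apply: meq_mul; [exact: meq_recast|exact: meq_refl].
have h_bij : bijective
    (fun p : 'I_N * j.-tuple 'I_N => [tuple of p.1 :: p.2]).
  exists (fun t => (thead t, [tuple of behead t])) => [[i t]|t] /=.
    by congr (_, _); apply: val_inj.
  by rewrite [RHS]tuple_eta; apply: val_inj.
rewrite (reindex _ (onW_bij _ h_bij)) /=.
transitivity (\sum_(i < N | (0 < i < k.+1)%N)
    \sum_(t : j.-tuple 'I_N |
        all (leq 1) (map val t) && (sumn (map val t) == k - i)%N)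
      recast (n ^ j.+1) (n ^ k) (tprod T (map val (i :: t))) *m kpow z k);
    last first.
  rewrite pair_big_dep; apply: eq_bigl => -[i t] /=.
  rewrite ltnS; case: (posnP i) => [//|i0] /=.
  by case: (all _ _) => /=; [apply/idP/idP; lia|rewrite andbF].
rewrite jetmx_kpowS//.
pose G i := jetmx i P z *t jetmx (k - i) (fun x => kpow (P x) j) z.
rewrite -[X in castmx _ X]/(\sum_(i < k.+1) G i) (big_ord_widen N G kN).
rewrite castmx_sum big_mkcond [RHS]big_mkcond; apply: eq_bigr => i _.
case: (posnP i) => [->|i0] /=.
  rewrite /G P0 tens0mx; apply/matrixP => a b.
  by rewrite castmxE !mxE.
case: ifP => // ik; rewrite /G PT// (IH (k - i)%N); last by lia.
rewrite tensmx_sumr castmx_sum; apply: eq_bigr => t /andP[_ /eqP st].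
have Ei : (i + (k - i) = k)%N by lia.
have e1 : (n ^ size (map val t) = n ^ j)%N by rewrite size_map size_tuple.
have e2 : (n ^ sumn (map val t) = n ^ (k - i))%N by rewrite st.
apply: meqP; apply: meq_trans (meq_cast _ _) _.
rewrite -tensmx_mul.
apply: meq_mul.
  apply: meq_trans (meq_tens (meq_refl _) (meq_recast _ e1 e2)) _.
  apply: meq_sym; apply: meq_trans (meq_recast _ _ _) _.
  - by rewrite /= expnS e1 expnS.
  - by rewrite /= st Ei.
  exact: meq_cast.
by have := meq_kpowD z i (k - i); rewrite Ei => /meq_sym.
Qed.

End Jets.

(** * Composition, Jacobians and pulled-back vector fields *)

Lemma smooth_mx_comp (R : realType) (n p a b : nat) (U : set 'cV[R]_n)
    (W : set 'cV[R]_p) (P : 'cV[R]_n -> 'cV[R]_p) (h : 'cV[R]_p -> 'M[R]_(a, b)) :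
  open U -> (forall x, U x -> W (P x)) -> smooth_mx U P -> smooth_mx W h ->
  smooth_mx U (fun x => h (P x)).
Proof.
move=> oU UW sP sh i j N.
by apply: (Cn_comp (F := fun y => h y i j) oU UW) => [k|]; [exact: sP|exact: sh].
Qed.

(** Removing from [h] its Taylor polynomial of degree [k] leaves a function [E]
without Taylor parts up to degree [k], hence flat, and then [E \o P] is flat
too and does not contribute in degree [k]. *)
Lemma jetmx_comp (R : realType) (n r : nat) (U W : set 'cV[R]_n)
    (P : 'cV[R]_n -> 'cV[R]_n) (h : 'cV[R]_n -> 'cV[R]_r)
    (C : forall k, 'M[R]_(r, n ^ k)) (T : forall k, 'M[R]_(n, n ^ k)) k z :
  open U -> U 0 -> open W -> W 0 -> (forall x, U x -> W (P x)) -> P 0 = 0 ->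
  smooth_mx U P -> smooth_mx W h ->
  (forall i, (0 < i)%N -> jetmx i P z = T i *m kpow z i) ->
  (forall l y, jetmx l h y = C l *m kpow y l) ->
  jetmx k (fun x => h (P x)) z =
    (\sum_(0 <= j < k.+1) C j *m Tcal T j k) *m kpow z k.
Proof.
move=> oU U0 oW W0 UW P0 sP sh PT hC.
have sk V j : open V -> smooth_mx V (fun y : 'cV[R]_n => kpow y j).
  by move=> oV; apply: smooth_mx_kpow => //; exact: smooth_mx_id.
(* [E] is the remainder of [h] after its Taylor polynomial of degree [k]. *)
pose E y := h y + \sum_(j < k.+1) (- C j) *m kpow y j.
have sEk (j : 'I_k.+1) : smooth_mx W (fun y => (- C j) *m kpow y j).
  by apply: smooth_mxM => //; [exact: smooth_mx_cst|exact: sk].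
have sE : smooth_mx W E by apply: smooth_mxD => //; exact: smooth_mx_sum.
have tE l y : (l <= k)%N -> jetmx l E y = 0.
  move=> lk; rewrite (jetmxD oW W0)//; last exact: smooth_mx_sum.
  rewrite (jetmx_sum oW W0)// hC.
  have tk (j : 'I_k.+1) :
      jetmx l (fun y => (- C j) *m kpow y j) y = (- C j) *m ((l == j)%:R *: kpow y j).
    by rewrite (jetmx_cstM oW W0) ?(jetmx_kpow oW W0)//; exact: sk.
  under eq_bigr do rewrite tk.
  rewrite (bigD1 (Ordinal (lk : (l < k.+1)%N)))//= eqxx scale1r mulNmx.
  rewrite big1 ?addr0 ?subrr// => j /negPf jl.
  by rewrite (_ : (l == j) = false) ?scale0r ?mulmx0// eq_sym; exact: jl.
have P00 : jetmx 0 P z = 0 by apply/matrixP => i j; rewrite !mxE /= P0 mxE.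
have tEP : jetmx k (fun x => E (P x)) z = 0.
  apply/matrixP => i j; rewrite !mxE.
  have fE : flat k (fun y => E y i j).
    apply: (jet_flat oW W0) => [|l y lk]; first exact: sE.
    by have /matrixP/(_ i j) := tE l y lk; rewrite !mxE.
  have := flat_comp oU U0 UW P0 (fun i => sP i 0) (sE i j) fE.
  exact: flat_jet.
have sPk (j : 'I_k.+1) : smooth_mx U (fun x => C j *m kpow (P x) j).
  by apply: smooth_mxM => //; [exact: smooth_mx_cst|exact: smooth_mx_kpow].
rewrite (_ : (fun x => _) = fun x => E (P x) + \sum_(j < k.+1) C j *m kpow (P x) j);
    last first.
  apply/funext => x; rewrite /E -addrA -big_split big1 ?addr0// => j _.
  by rewrite /= mulNmx addNr.
rewrite (jetmxD oU U0); [|exact: smooth_mx_comp sE|exact: smooth_mx_sum].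
rewrite tEP add0r (jetmx_sum oU U0)// big_mkord mulmx_suml; apply: eq_bigr => j _.
rewrite (jetmx_cstM oU U0); last exact: smooth_mx_kpow.
by rewrite (jetmx_Tcal oU U0 _ _ sP P00 PT) mulmxA.
Qed.

Lemma kpow_dirS (R : realType) (n k : nat) (z v : 'cV[R]_n) :
  kpow_dir z v k.+1 = castmx (esym (expnS n k), muln1 1)
    (v *t kpow z k + z *t kpow_dir z v k).
Proof. by []. Qed.

Lemma tens_cV (R : realType) (p q : nat) (x : 'cV[R]_p) (y : 'cV[R]_q)
    (i : 'I_(p * q)) (j : 'I_(1 * 1)) :
  (x *t y) i j = x (mxtens_unindex i).1 0 * y (mxtens_unindex i).2 0.
Proof.
by rewrite mxE !ord1.
Qed.

Lemma jac_kpow (R : realType) (n k : nat) (z v : 'cV[R]_n) :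
  jac (fun x => kpow x k) z *m v = kpow_dir z v k.
Proof.
have oT : open (setT : set 'cV[R]_n) by exact: openT.
have sk j : smooth_mx setT (fun y : 'cV[R]_n => kpow y j).
  by apply: smooth_mx_kpow => //; exact: smooth_mx_id.
have dk j i x : differentiable (fun y : 'cV[R]_n => kpow y j i 0) x.
  exact: smooth_diff (sk j i 0) I.
have jacE j : jac (fun x => kpow x j) z =
    \matrix_(i, b) 'D_(unitvec b) (fun y => kpow y j i 0) z.
  apply/matrixP => i b; rewrite !mxE derive_entry//.
  by apply: differentiable_mx => i' j'; rewrite ord1; exact: dk.
elim: k => [|k IH].
  apply/matrixP => i b; rewrite !mxE big1// => c _.
  by rewrite jacE !mxE (_ : 'D_(unitvec c) _ z = 0) ?mul0r//; exact: (derive_cst (kpow z 0 i 0) z (unitvec c)).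
apply/matrixP => i b; rewrite [b]ord1 kpow_dirS castmxE.
pose i' := mxtens_unindex (cast_ord (expnS n k) i).
have kS (y : 'cV[R]_n) : kpow y k.+1 i 0 = y i'.1 0 * kpow y k i'.2 0.
  by rewrite kpowS castmxE tens_cV esymK.
rewrite mxE [X in _ = X]mxE !tens_cV esymK -/i'.
have DE c : 'D_(unitvec c) (fun y : 'cV[R]_n => kpow y k.+1 i 0) z =
    (i'.1 == c)%:R * kpow z k i'.2 0 +
    z i'.1 0 * 'D_(unitvec c) (fun y : 'cV[R]_n => kpow y k i'.2 0) z.
  rewrite -(derive_coord z) -deriveM_fun//; last exact: differentiable_coord.
  by congr ('D_(unitvec c) _ z); apply/funext => y; exact: kS.
rewrite jacE; under eq_bigr do rewrite mxE DE mulrDl.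
rewrite big_split /=; congr (_ + _).
  rewrite (bigD1 i'.1)//= eqxx mul1r mulrC big1 ?addr0// => c /negPf.
  by rewrite eq_sym => ->; rewrite !mul0r.
rewrite -IH jacE mxE mulr_sumr; apply: eq_bigr => c _.
by rewrite mxE mulrA.
Qed.

(** Cramer's rule: the entries are polynomials in those of [A], divided by the
determinant. *)
Lemma smooth_mx_inv (R : realType) (n p : nat) (U : set 'cV[R]_n)
    (A : 'cV[R]_n -> 'M[R]_p) : open U -> (forall x, U x -> A x \in unitmx) ->
  smooth_mx U A -> smooth_mx U (fun x => invmx (A x)).
Proof.
move=> oU uA sA.
have sdet q (B : 'cV[R]_n -> 'M[R]_q) : smooth_mx U B -> smooth_on U (fun x => \det (B x)).
  move=> sB N; apply: Cn_sum => // s _; apply: Cn_mul => //; first exact: Cn_cst.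
  by apply: Cn_prod => // i _; exact: sB.
have sadj i j : smooth_on U (fun x => \adj (A x) i j).
  rewrite (_ : (fun x => _) = fun x => (-1) ^+ (j + i) * \det (row' j (col' i (A x)))).
    apply: smoothM => //; first exact: smooth_cst.
    apply: sdet => a b; rewrite (_ : (fun x => _) = fun x => A x (lift j a) (lift i b)).
      exact: sA.
    by apply/funext => x; rewrite !mxE.
  by apply/funext => x; rewrite mxE.
move=> i j N; apply: (Cn_eq (F := fun x => (\det (A x))^-1 * \adj (A x) i j)) => //.
  by move=> x /[!inE] Ux; rewrite /invmx (uA _ Ux) [RHS]mxE.
apply: Cn_mul => //; last exact: sadj.
apply: Cn_inv => // [x Ux|]; last exact: sdet.
by rewrite -unitfE -unitmxE; exact: uA.
Qed.

Section VectorField.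
Context {R : realType} {n : nat}.
Variables (U W : set 'cV[R]_n) (P : 'cV[R]_n -> 'cV[R]_n).
Hypotheses (oU : open U) (U0 : U 0) (oW : open W) (W0 : W 0).
Hypotheses (UW : forall x, U x -> W (P x)) (P0 : P 0 = 0).
Hypothesis sP : smooth_mx U P.
Variable T : forall k, 'M[R]_(n, n ^ k).
Hypothesis PT : forall i z, (0 < i)%N -> jetmx i P z = T i *m kpow z i.
Hypothesis T1_unit : (T 1%N : 'M[R]_n) \in unitmx.
Hypothesis uJ : forall x, U x -> jac P x \in unitmx.

Let jacE : {in U, jac P =1 fun x => \matrix_(i, j) 'D_(unitvec j) (fun y => P y i 0) x}.
Proof.
move=> x /[!inE] Ux; apply/matrixP => i j; rewrite !mxE derive_entry//.
by apply: differentiable_mx => a b; rewrite ord1; exact: smooth_diff (sP a 0) Ux.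
Qed.

Lemma smooth_mx_jac : smooth_mx U (jac P).
Proof.
move=> i j N; apply: (Cn_eq (F := 'D_(unitvec j) (fun y => P y i 0))) => //.
  by move=> x Ux; rewrite jacE// mxE.
exact/smooth_derive/sP.
Qed.

(** Taking Taylor parts commutes with partial derivatives ([jet_derive]), so the
degree [k] part of the Jacobian is the Jacobian of
[x |-> T k.+1 *m kpow x k.+1]. *)
Lemma jetmx_jac k z v : jetmx k (jac P) z *m v = T k.+1 *m kpow_dir z v k.+1.
Proof.
rewrite -jac_kpow mulmxA; congr (_ *m v).
rewrite (jetmx_eq oU U0 _ _ jacE); apply/matrixP => i j; rewrite mxE.
rewrite (_ : (fun x => _) = 'D_(unitvec j) (fun y => P y i 0)); last first.
  by apply/funext => x; rewrite mxE.
rewrite -(jet_derive oU U0 k z j (sP i 0)).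
have dk l (x : 'cV[R]_n) : differentiable (fun y : 'cV[R]_n => kpow y k.+1 l 0) x.
  have sk : smooth_mx setT (fun y : 'cV[R]_n => kpow y k.+1).
    by apply: smooth_mx_kpow; [exact: openT|exact: smooth_mx_id].
  exact: smooth_diff (sk l 0) I.
have dcst (c : R) : differentiable (fun _ : 'cV[R]_n => c) z.
  exact: differentiable_cst.
have -> : jet k.+1 (fun y => P y i 0) =
    \sum_l (fun y : 'cV[R]_n => T k.+1 i l * kpow y k.+1 l 0).
  apply/funext => y; rewrite fct_sumE.
  by have /matrixP/(_ i 0) := PT y (ltn0Sn k); rewrite !mxE.
rewrite derive_sum => [|l]; last first.
  exact/diff_derivable/(differentiableM (dcst _) (dk _ _)).
rewrite mxE; apply: eq_bigr => l _.
rewrite (deriveM_fun _ (dcst _) (dk _ _)) derive_cst mul0r add0r mxE.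
rewrite derive_entry//.
by apply: differentiable_mx => a b; rewrite ord1; exact: dk.
Qed.

Variables (w : 'cV[R]_n -> 'cV[R]_n) (C Wb : forall k, 'M[R]_(n, n ^ k)).
Hypothesis sw : smooth_mx W w.
Hypothesis wC : forall l y, jetmx l w y = C l *m kpow y l.
Hypothesis WbE : forall k, Wb k = invmx (T 1%N : 'M[R]_n) *m
  (\sum_(0 <= j < k.+1) C j *m Tcal T j k
   - \sum_(2 <= i < k.+2)
       T i *m recast (n ^ i) (n ^ k) (lyap i (Wb (k.+1 - i)%N))).

Let wb x := invmx (jac P x) *m w (P x).

Lemma smooth_mx_pullback : smooth_mx U wb.
Proof.
apply: smooth_mxM => //; last exact: smooth_mx_comp sw.
by apply: smooth_mx_inv => //; exact: smooth_mx_jac.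
Qed.

(** The degree [k] parts of [jac P x *m wb x = w (P x)] are compared. The degree 0
part of the Jacobian is [T 1], which is invertible; the other parts multiply
the parts of [wb] of degree less than [k], known by induction. *)
Lemma jetmx_pullback k z : jetmx k wb z = Wb k *m kpow z k.
Proof.
have [m] := ubnP k; elim: m k => // m IH k; rewrite ltnS => km.
have sb := smooth_mx_pullback.
have E : jetmx k (fun x => jac P x *m wb x) z =
    (\sum_(0 <= j < k.+1) C j *m Tcal T j k) *m kpow z k.
  rewrite -(jetmx_comp _ oU U0 oW W0 UW P0 sP sw (fun i => PT z (i := i)) wC).
  by apply: (jetmx_eq oU U0) => x /[!inE] Ux; rewrite /wb mulKVmx//; exact: uJ.
move: E; rewrite (jetmxM oU U0 _ _ smooth_mx_jac sb) big_ord_recl subn0 jetmx_jac.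
have -> : kpow_dir z (jetmx k wb z) 1 = jetmx k wb z.
  rewrite /= [z *t _]tensmx0 addr0; apply: meqP; apply: meq_trans (meq_cast _ _) _.
  by apply: meq_trans (meq_tens (meq_refl _) (meq_kpow _ _)) _; exact: meq_tens1.
under eq_bigr => i _.
  rewrite jetmx_jac IH; last first.
    by rewrite lift0; have := ltn_ord i; lia.
  rewrite -(lyap_kpow (k := k)) ?mulmxA//; last first.
    by rewrite lift0; have := ltn_ord i; lia.
  over.
rewrite WbE => E.
apply: (can_inj (mulKmx T1_unit)).
rewrite mulmxA mulmxA mulmxV// mul1mx mulmxBl -E mulmx_suml.
rewrite big_add1 big_add1 big_mkord /=.
by rewrite addrK.
Qed.

End VectorField.

(** * The balanced realization *)

(** Course-of-values recursion for a dependent family, by iterating [step] on the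
whole family: the value at [k] is stable after [k + 1] iterations. *)
Lemma recursive_family (X : nat -> Type) (x0 : forall k, X k)
    (step : forall k, (forall p, X p) -> X k) :
  (forall k x y, (forall p, (p < k)%N -> x p = y p) -> step k x = step k y) ->
  exists x : forall k, X k, forall k, x k = step k x.
Proof.
move=> stepP.
pose xn := fix xn N := if N is N'.+1 then fun k => step k (xn N') else x0.
have xnE N M k : (k < N)%N -> (k < M)%N -> xn N k = xn M k.
  elim: N M k => [//|N IH] [//|M] k; rewrite !ltnS => kN kM /=.
  by apply: stepP => p pk; apply: IH; exact: leq_trans pk _.
exists (fun k => xn k.+1 k) => k /=; apply: stepP => p pk.
exact: (xnE _ _ _ pk (ltnSn p)).
Qed.

Section Final.
Context {R : realType} {n : nat}.

(** The right-hand side of the recursion for the coefficients of a pulled-back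
vector field, as a functional of the family [X] of these coefficients. *)
Definition pullback_coef (T : forall k, 'M[R]_(n, n ^ k)) (C : forall k, 'M[R]_(n, n ^ k)) k
   (X : forall k, 'M[R]_(n, n ^ k)) : 'M[R]_(n, n ^ k) :=
  invmx (T 1%N : 'M[R]_n) *m
  (\sum_(0 <= j < k.+1) C j *m Tcal T j k
   - \sum_(2 <= i < k.+2)
       T i *m recast (n ^ i) (n ^ k) (lyap i (X (k.+1 - i)%N))).

Lemma pullback_coef_exists T C : exists X, forall k, X k = pullback_coef T C k X.
Proof.
apply: recursive_family => [k|k x y xy]; first exact: 0.
rewrite /pullback_coef; congr (_ *m (_ - _)); apply: eq_big_nat => i /andP[i2 ik].
by rewrite xy//; lia.
Qed.

Lemma smooth_mx_sub (U W : set 'cV[R]_n) a b (A : 'cV[R]_n -> 'M[R]_(a, b)) :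
  U `<=` W -> smooth_mx W A -> smooth_mx U A.
Proof. by move=> UW sA i j N; apply: Cn_subset UW _; exact: sA. Qed.

Lemma recast0 a b c d : recast c d (0 : 'M[R]_(a, b)) = 0.
Proof.
rewrite /recast; have [ac|ac] := eqVneq a c.
  have [bd|bd] := eqVneq b d; first by subst c d; rewrite conform_mx_id.
  by rewrite nonconform_mx// bd orbT.
by rewrite nonconform_mx// ac.
Qed.

Lemma lyap0 p q k : lyap k (0 : 'M[R]_(p, q)) = 0.
Proof.
by rewrite /lyap big1_seq// => i _; rewrite tens0mx tensmx0 recast0.
Qed.

(** The identity matrix in [1%:M *t kpow x k] selects the block of [G k] that
belongs to the column. *)
Lemma input_term_col m (G : forall p, 'M[R]_(n, m * n ^ p)) k x l :
  col l (input_term G k x) = block (G k) l *m kpow x k.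
Proof.
apply/matrixP => i j; rewrite ord1 mxE castmxE !mxE /=.
have -> : cast_ord (esym (muln1 m)) l = mxtens_index (l, ord0).
  by apply: val_inj; rewrite /= muln1 addn0.
rewrite (reindex (@mxtens_index m (n ^ k))) /=; last first.
  by apply: onW_bij; exists (@mxtens_unindex _ _);
    [exact: mxtens_indexK|exact: mxtens_unindexK].
transitivity (\sum_a \sum_b G k i (mxtens_index (a, b)) *
    ((a == l)%:R * kpow x k b 0)).
  rewrite pair_bigA; apply: eq_bigr => -[a b] _ /=.
  by rewrite cast_ord_id -[ord0](erefl (0 : 'I_1)) tensmxE !mxE.
rewrite (bigD1 l)//= [X in _ + X]big1 ?addr0 => [|a /negPf al].
  by apply: eq_bigr => b _; rewrite eqxx mul1r mxE.
by apply: big1 => b _; rewrite al mul0r mulr0.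
Qed.

Lemma series_jets r (h : 'cV[R]_n -> 'cV[R]_r) (C : forall k, 'M[R]_(r, n ^ k)) :
  has_series h (vec_term C) -> exists W : set 'cV[R]_n,
    [/\ open W, W 0, smooth_mx W h & forall k x, jetmx k h x = vec_term C k x].
Proof.
move=> [/smooth_near0_mx[W [oW W0 sh hE]] hC]; exists W; split=> // k x.
by rewrite -hE hC.
Qed.

(** A series that starts at degree 1, read as a series that starts at degree 0. *)
Definition drop0 r (C : forall k, 'M[R]_(r, n ^ k)) k : 'M[R]_(r, n ^ k) :=
  if k is k'.+1 then C k'.+1 else 0.

Lemma vec_term_drop0 r (C : forall k, 'M[R]_(r, n ^ k)) k x :
  vec_term C k x = drop0 C k *m kpow x k.
Proof. by case: k => [|k]; rewrite ?mul0mx. Qed.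

Lemma sum_drop0 r (C : forall k, 'M[R]_(r, n ^ k)) T k :
  \sum_(0 <= j < k.+1) drop0 C j *m Tcal T j k =
  \sum_(1 <= j < k.+1) C j *m Tcal T j k.
Proof.
rewrite big_nat_recl// mul0mx add0r [RHS]big_add1 /=.
by [].
Qed.

End Final.

Theorem theorem3p2 (R : realType) (n m r : nat)
  (f : 'cV[R]_n -> 'cV[R]_n) (g : 'cV[R]_n -> 'M[R]_(n, m))
  (h : 'cV[R]_n -> 'cV[R]_r)
  (F : forall p, 'M[R]_(n, n ^ p)) (G : forall p, 'M[R]_(n, m * n ^ p))
  (H : forall p, 'M[R]_(r, n ^ p))
  (hf : has_series f (vec_term F))
  (hg : has_series g (input_term G))
  (hh : has_series h (vec_term H))
  (lin_minimal : minimal (jac f 0) (g 0) (jac h 0))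
  (lin_stable : asymptotically_stable (jac f 0))
  (lin_hsv : distinct_hankel_singular_values (jac f 0) (g 0) (jac h 0))
  (Ec Eo : 'cV[R]_n -> R)
  (hEc : is_controllability_energy f g Ec) (Ec_smooth : smooth_near0 Ec)
  (hEo : is_observability_energy f h Eo) (Eo_smooth : smooth_near0 Eo)
  (Phi : 'cV[R]_n -> 'cV[R]_n) (hPhi : is_balancing Ec Eo Phi)
  (T : forall k, 'M[R]_(n, n ^ k))
  (hT : has_series Phi (vec_term T))
  (T1_inv : (T 1%N : 'M[R]_n) \in unitmx) :
  exists (Fb : forall p, 'M[R]_(n, n ^ p))
         (Gb : forall p, 'M[R]_(n, m * n ^ p))
         (Hb : forall p, 'M[R]_(r, n ^ p)),
    [/\ forall k : nat, (1 <= k)%N ->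
          Fb k = invmx (T 1%N : 'M[R]_n) *m
            (\sum_(1 <= j < k.+1) F j *m Tcal T j k
             - \sum_(2 <= i < k.+1)
                 T i *m recast (n ^ i) (n ^ k) (lyap i (Fb (k.+1 - i)%N))),
        forall (k : nat) (l : 'I_m),
          block (Gb k) l = invmx (T 1%N : 'M[R]_n) *m
            (\sum_(0 <= j < k.+1) block (G j) l *m Tcal T j k
             - \sum_(2 <= i < k.+2)
                 T i *m recast (n ^ i) (n ^ k)
                          (lyap i (block (Gb (k.+1 - i)%N) l))),
        forall k : nat, (1 <= k)%N ->
          Hb k = \sum_(1 <= j < k.+1) H j *m Tcal T j k
      & [/\ has_series (fun z => invmx (jac Phi z) *m f (Phi z)) (vec_term Fb),
            has_series (fun z => invmx (jac Phi z) *m g (Phi z))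
                       (input_term Gb)
          & has_series (fun z => h (Phi z)) (vec_term Hb)]].
Proof.
have [Wf [oWf Wf0 sf fC]] := series_jets hf.
have [Wh [oWh Wh0 sh hC]] := series_jets hh.
have [UP [oUP UP0 sPhi PhiC]] := series_jets hT.
have [/smooth_near0_mx[Wg [oWg Wg0 sg gE]] gC] := hg.
have [_ Phi0 uJ _] := hPhi.
(* One neighbourhood on which all three fields are smooth. *)
pose W := Wf `&` Wg `&` Wh.
have oW : open W by apply: openI => //; exact: openI.
have W0 : W 0 by [].
have {}sf : smooth_mx W f by apply: smooth_mx_sub sf => x [[]].
have {}sg : smooth_mx W g by apply: smooth_mx_sub sg => x [[]].
have {}sh : smooth_mx W h by apply: smooth_mx_sub sh => x [].
have {}PhiC i z : (0 < i)%N -> jetmx i Phi z = T i *m kpow z i.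
  by rewrite PhiC; case: i.
have [U [oU U0 UUP UW UJ]] : exists U : set 'cV[R]_n,
    [/\ open U, U 0, U `<=` UP, forall x, U x -> W (Phi x) &
        forall x, U x -> jac Phi x \in unitmx].
  have dPhi : differentiable Phi 0.
    by apply: differentiable_mx => i j; exact: smooth_diff (sPhi i j) UP0.
  have nW : \forall x \near (0 : 'cV[R]_n), W (Phi x).
    have nW0 : nbhs (Phi 0) W by rewrite Phi0; exact: open_nbhs_nbhs.
    exact: (differentiable_continuous dPhi nW0).
  have nU : \forall x \near (0 : 'cV[R]_n), UP x by exact: open_nbhs_nbhs.
  have : \forall x \near (0 : 'cV[R]_n),
      [/\ UP x, W (Phi x) & jac Phi x \in unitmx].
    by near=> x; split; near: x.
  rewrite -nbhs_nearE nbhsE => -[V [oV V0] VP].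
  by exists V; split=> // x /VP [].
have {}sPhi : smooth_mx U Phi by exact: smooth_mx_sub sPhi.
have [Fb FbE] := pullback_coef_exists T (drop0 F).
(* The drift vanishes at the origin, hence so does the pulled-back drift. *)
have Fb0 : Fb 0%N = 0.
  by rewrite FbE /pullback_coef big_nat1 mul0mx big_geq// subr0 mulmx0.
have GbP l : exists X, forall k, X k = pullback_coef T (fun k => block (G k) l) k X.
  exact: pullback_coef_exists.
have [Gl GlE] := choice GbP.
(* The columns of the input map are pulled back separately; [Gl l] is the
   family of coefficients of column [l]. *)
pose Gb k : 'M[R]_(n, m * n ^ k) :=
  \matrix_(i, j) Gl (mxtens_unindex j).1 k i (mxtens_unindex j).2.
have GbE k l : block (Gb k) l = Gl l k.
  by apply/matrixP => i j; rewrite !mxE mxtens_indexK.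
exists Fb, Gb, (fun k => \sum_(1 <= j < k.+1) H j *m Tcal T j k); split.
- move=> k k1; rewrite [LHS]FbE /pullback_coef sum_drop0 [in LHS](big_nat_recr _ 2)//=.
  by rewrite subnn Fb0 lyap0 recast0 mulmx0 addr0.
- move=> k l; rewrite GbE [LHS]GlE /pullback_coef.
  by congr (_ *m (_ - _)); apply: eq_bigr => i _; rewrite GbE.
- by [].
split.
- have sb := smooth_mx_pullback oU UW sPhi UJ sf.
  have [? E] := smooth_mx_near0 oU U0 sb; split=> // k x.
  rewrite E (jetmx_pullback oU U0 oW W0 UW Phi0 sPhi PhiC T1_inv UJ sf _ FbE).
    by case: k => [|k]; rewrite ?Fb0 ?mul0mx.
  by move=> k' y; rewrite fC vec_term_drop0.
- have tg l k x : jetmx k (fun y => col l (g y)) x = block (G k) l *m kpow x k.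
    rewrite -input_term_col -gC gE; apply/matrixP => i j; rewrite !mxE.
    by congr (jet k _ x); apply/funext => y; rewrite mxE.
  have sgl l : smooth_mx W (fun y => col l (g y)).
    move=> i j; rewrite (_ : (fun y => _) = fun y => g y i l); first exact: sg.
    by apply/funext => y; rewrite mxE.
  pose gb z := invmx (jac Phi z) *m g (Phi z).
  have gbE i l : (fun z => gb z i l) =
      (fun z => (invmx (jac Phi z) *m col l (g (Phi z))) i 0).
    by apply/funext => z; rewrite colE mulmxA -colE [RHS]mxE.
  have sb : smooth_mx U gb.
    move=> i l; rewrite gbE.
    exact: (smooth_mx_pullback oU UW sPhi UJ (sgl l)).
  have [? E] := smooth_mx_near0 oU U0 sb; split=> // k x.
  rewrite E; apply/matrixP => i l; rewrite mxE gbE.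
  have := jetmx_pullback oU U0 oW W0 UW Phi0 sPhi PhiC T1_inv UJ (sgl l) (tg l)
    (GlE l) k x.
  move/matrixP/(_ i 0); rewrite mxE => ->.
  by rewrite -GbE -input_term_col mxE.
- have sb := smooth_mx_comp oU UW sPhi sh.
  have [? E] := smooth_mx_near0 oU U0 sb; split=> // k x.
  rewrite E (jetmx_comp (C := drop0 H) (T := T) _ oU U0 oW W0 UW Phi0 sPhi sh).
  - case: k => [|k] /=; last by rewrite sum_drop0.
    by rewrite big_nat1 !mul0mx.
  - by move=> i; exact: PhiC.
  - by move=> l y; rewrite hC vec_term_drop0.
Unshelve. all: by end_near.
Qed.
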